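(* Let $F_m$ denote the $m$-th Fibonacci number ($F_0=0$, $F_1=1$, $F_{i+1}=F_i+F_{i-1}$). For $n\ge1$, let $s_n$ be the number of states of the finite state automaton $\Gamma_n$ accepting the language of maximal (or minimal) lexicographic representatives of elements of the positive braid monoid $A_n$. Then $$s_n=\sum_{i=1}^n\left(\binom{n+1-i}{2}+1\right)F_{2i}.$$
   Context: For $n\ge 1$, $A_n$ is the positive braid monoid with $n$ generators, i.e. the monoid with generators $a_1,\ldots,a_n$ and relations $a_ia_j=a_ja_i$ if $|i-j|>1$, and $a_ia_ja_i=a_ja_ia_j$ if $|i-j|=1$. All words representing a given element have the same length. Order the letters by $a_1<\cdots<a_n$. For $\beta\in A_n$, $\omega(\beta)$ denotes its maximal lexicographic representative: the lexicographically biggest word in $a_1,\dots,a_n$ representing $\beta$. Let $\mathcal L_n=\{\omega(\beta):\beta\in A_n\}$. Write $\gamma\preccurlyeq\beta$ if $\beta=\gamma\delta$ for some $\delta\in A_n$. For $\beta_1\in A_n$, the set of minimal forbidden prefixes after $\beta_1$ is $$F_n(\beta_1)=\min_{\preccurlyeq}\{\beta_2\in A_n:\ \omega(\beta_1\beta_2)\ne\omega(\beta_1)\omega(\beta_2)\},$$ the set of $\preccurlyeq$-minimal elements of the displayed set. The automaton $\Gamma_n$ is the directed labeled graph whose vertices (states) are the distinct sets of the form $F_n(\beta_1)$, $\beta_1\in A_n$, with initial state $F_n(1)=\emptyset$, all states accepting, and, whenever $a_j\notin F_n(\beta_1)$, an arrow labeled $a_j$ from $F_n(\beta_1)$ to $F_n(\beta_1a_j)$.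 It is a well defined deterministic finite state automaton with accepted language $\mathcal L_n$, and it is the one with the smallest number of states among deterministic finite state automata accepting $\mathcal L_n$ (here deterministic means at most one outgoing arrow per state and letter, and all states are accepting). The smallest such automaton for the language of minimal (lexicographically smallest) representatives is obtained from $\Gamma_n$ by replacing each label $a_i$ with $a_{n+1-i}$, hence has the same number of states. The Fibonacci numbers $F_m$ are not to be confused with the sets $F_n(\beta)$. *)

(* Defs.v *)
From HB Require Import structures.
From mathcomp Require Import all_boot all_order ssralg ssrint.
From mathcomp Require Import boolp classical_sets functions cardinality.
Set Implicit Arguments.
Unset Strict Implicit.
Unset Printing Implicit Defensive.
Import Order.TTheory.
Local Open Scope quotient_scope.
Local Open Scope classical_set_scope.
Local Open Scope nat_scope.

(* Words in the n generators. The generator a_k of the usual 1-based notation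
   is the element of 'I_n with value k - 1. *)
Notation word n := (seq 'I_n).

(* The congruence on words generated by the braid relations. *)
Inductive braid_eq (n : nat) : word n -> word n -> Prop :=
| braid_eq_refl u : braid_eq u u
| braid_eq_sym u v : braid_eq u v -> braid_eq v u
| braid_eq_trans u v w : braid_eq u v -> braid_eq v w -> braid_eq u w
| braid_eq_far u v (i j : 'I_n) : 1 < `|i - j|%N ->
    braid_eq (u ++ [:: i; j] ++ v) (u ++ [:: j; i] ++ v)
| braid_eq_near u v (i j : 'I_n) : `|i - j|%N = 1 ->
    braid_eq (u ++ [:: i; j; i] ++ v) (u ++ [:: j; i; j] ++ v).

Definition braid_eqb (n : nat) : rel (word n) := fun u v => `[< braid_eq u v >].

Lemma braid_eqb_refl n : reflexive (@braid_eqb n).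
Proof. by move=> u; apply/asboolP; exact: braid_eq_refl. Qed.

Lemma braid_eqb_sym n : symmetric (@braid_eqb n).
Proof.
by move=> u v; apply/asboolP/asboolP => H; exact: braid_eq_sym.
Qed.

Lemma braid_eqb_trans n : transitive (@braid_eqb n).
Proof.
move=> v u w /asboolP uv /asboolP vw; apply/asboolP.
exact: braid_eq_trans uv vw.
Qed.

Canonical braid_equiv n :=
  EquivRel (@braid_eqb n) (@braid_eqb_refl n) (@braid_eqb_sym n)
    (@braid_eqb_trans n).

Definition braid (n : nat) : Type := {eq_quot @braid_eqb n}.
HB.instance Definition _ n := Choice.on (braid n).
HB.instance Definition _ n := EqQuotient.on (braid n).

Definition eval (n : nat) (w : word n) : braid n := \pi_(braid n) w.

Lemma eval_eq n (u v : word n) : eval u = eval v <-> braid_eq u v.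
Proof.
split=> [/eqP|uv]; first by rewrite /eval eqmodE => /asboolP.
by apply/eqP; rewrite /eval eqmodE; apply/asboolP.
Qed.

Lemma eval_repr n (b : braid n) : eval (repr b) = b.
Proof. exact: reprK. Qed.

Lemma braid_eq_ctx n (p q u v : word n) :
  braid_eq u v -> braid_eq (p ++ u ++ q) (p ++ v ++ q).
Proof.
elim=> {u v} [u|u v _|u v w _ uv _|u v i j ij|u v i j ij].
- exact: braid_eq_refl.
- exact: braid_eq_sym.
- exact: braid_eq_trans uv.
- by have := braid_eq_far (p ++ u) (v ++ q) ij; rewrite -!catA.
- by have := braid_eq_near (p ++ u) (v ++ q) ij; rewrite -!catA.
Qed.

Definition braid_mul n (x y : braid n) : braid n := eval (repr x ++ repr y).

Lemma eval_cat n (u v : word n) : eval (u ++ v) = braid_mul (eval u) (eval v).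
Proof.
apply/eval_eq; apply: (@braid_eq_trans _ _ (repr (eval u) ++ v)).
  apply: (@braid_eq_ctx n [::] v).
  by apply/eval_eq; rewrite eval_repr.
have := @braid_eq_ctx n (repr (eval u)) [::] v (repr (eval v)).
by rewrite !cats0; apply; apply/eval_eq; rewrite eval_repr.
Qed.

Lemma braid_mulA n : associative (@braid_mul n).
Proof.
move=> x y z; rewrite -(eval_repr x) -(eval_repr y) -(eval_repr z).
by rewrite -!eval_cat catA.
Qed.

Lemma braid_mul1 n : left_id (eval [::]) (@braid_mul n).
Proof. by move=> x; rewrite -(eval_repr x) -eval_cat. Qed.

Lemma braid_1mul n : right_id (eval [::]) (@braid_mul n).
Proof. by move=> x; rewrite -(eval_repr x) -eval_cat cats0. Qed.

HB.instance Definition _ n :=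
  isMonoid.Build (braid n) (@braid_mulA n) (@braid_mul1 n) (@braid_1mul n).

Definition gen (n : nat) (j : 'I_n) : braid n := eval [:: j].

Definition lex_le (n : nat) (u v : word n) : bool := (u <= v :> seqlexi 'I_n)%O.

(* The default value [::] is never used: see max_repP and min_repP below. *)
Definition max_rep (n : nat) (b : braid n) : word n :=
  xget [::] [set u | eval u = b /\ forall v, eval v = b -> lex_le v u].

Definition min_rep (n : nat) (b : braid n) : word n :=
  xget [::] [set u | eval u = b /\ forall v, eval v = b -> lex_le u v].

Lemma braid_eq_size n (u v : word n) : braid_eq u v -> size u = size v.
Proof.
elim=> {u v} [//|u v _ -> //|u v w _ -> _ -> //|u v i j _|u v i j _];
  by rewrite !size_cat.
Qed.

Lemma extremal_rep_exists n (le : rel (word n)) (b : braid n) :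
  transitive le -> total le ->
  exists u, eval u = b /\ forall v, eval v = b -> le u v.
Proof.
move=> le_trans le_total.
pose k := size (repr b).
pose s := sort le [seq val t | t <- enum [pred t : k.-tuple 'I_n | eval t == b]].
have mem_s v : (v \in s) = (eval v == b).
  rewrite mem_sort; apply/mapP/idP => [[t]|vb].
    by rewrite mem_enum inE => tb ->.
  have vk : size v == k.
    apply/eqP/braid_eq_size/eval_eq.
    by rewrite eval_repr (eqP vb).
  by exists (Tuple vk); rewrite // mem_enum inE.
have := sort_sorted le_total [seq val t | t <- enum [pred t : k.-tuple 'I_n | eval t == b]].
have : repr b \in s by rewrite mem_s eval_repr.
rewrite -/s; case: s mem_s => // u s mem_s _ /= us; exists u; split.
  by apply/eqP; rewrite -mem_s mem_head.
move=> v /eqP; rewrite -mem_s inE => /predU1P[->|vs].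
  by have := le_total u u; rewrite orbb.
by have /allP := order_path_min le_trans us; apply.
Qed.

Lemma max_repP n (b : braid n) :
  eval (max_rep b) = b /\ forall v, eval v = b -> lex_le v (max_rep b).
Proof.
apply: (@xgetPex _ [::] [set u | eval u = b /\ forall v, _ -> lex_le v u]).
apply: (@extremal_rep_exists n (fun u v => lex_le v u)).
  by move=> v u w vu wv; exact: le_trans wv vu.
by move=> u v; exact: le_total.
Qed.

Lemma min_repP n (b : braid n) :
  eval (min_rep b) = b /\ forall v, eval v = b -> lex_le (min_rep b) v.
Proof.
apply: (@xgetPex _ [::] [set u | eval u = b /\ forall v, _ -> lex_le u v]).
by apply: (@extremal_rep_exists n (@lex_le n));
  [move=> v u w; exact: le_trans|move=> u v; exact: le_total].
Qed.

Definition max_lang (n : nat) : set (word n) := range (@max_rep n).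
Definition min_lang (n : nat) : set (word n) := range (@min_rep n).

Arguments max_lang n : clear implicits.
Arguments min_lang n : clear implicits.

Definition braid_prefix (n : nat) (c b : braid n) : Prop :=
  exists d : braid n, b = (c * d)%g.

Definition minimal_prefixes (n : nat) (S : set (braid n)) : set (braid n) :=
  [set b | S b /\ forall c, S c -> braid_prefix c b -> c = b].

Definition forbidden_prefixes (n : nat) (b1 : braid n) : set (braid n) :=
  minimal_prefixes
    [set b2 : braid n | max_rep (b1 * b2)%g <> max_rep b1 ++ max_rep b2].

(* Automata in which every state is accepting. An arrow needs not exist for
   every state and letter. *)
Record automaton (A : Type) := Automaton {
  carrier : Type;
  states : set carrier;
  initial : carrier;
  arrow : carrier -> A -> carrier -> Prop }.

Arguments states {A} a.
Arguments initial {A} a.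
Arguments arrow {A} a.

Fixpoint run (A : Type) (M : automaton A) (q : carrier M) (w : seq A) : Prop :=
  if w is a :: w' then exists2 q', arrow M q a q' & run q' w' else True.

Definition accepted (A : Type) (M : automaton A) : set (seq A) :=
  [set w | run (initial M) w].

Definition relabel (A B : Type) (f : A -> B) (M : automaton A) : automaton B :=
  {| carrier := carrier M; states := states M; initial := initial M;
     arrow := fun q b q' => exists2 a, b = f a & arrow M q a q' |}.

Definition Gamma (n : nat) : automaton 'I_n := {|
  carrier := set (braid n);
  states := range (@forbidden_prefixes n);
  initial := forbidden_prefixes 1%g;
  arrow := fun q j q' => exists b1 : braid n,
    [/\ q = forbidden_prefixes b1, ~ forbidden_prefixes b1 (gen j)
      & q' = forbidden_prefixes (b1 * gen j)%g] |}.

(* rev_ord maps the 1-based index i to n + 1 - i. *)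
Definition Gamma_min (n : nat) : automaton 'I_n :=
  relabel (@rev_ord n) (Gamma n).

Fixpoint fib (m : nat) : nat :=
  if m is m'.+1 then if m' is m''.+1 then fib m' + fib m'' else 1 else 0.

(* Main.v *)
(* A word is the greatest representative of its braid iff each of its suffixes
   starts with the greatest generator dividing it. Hence a_j can be appended to
   omega(b) unless a_j is forbidden, and the forbidden prefixes after b a_j are
   the minimal ones among the residues by a_j of those after b and of the a_k,
   k > j. Garside's lcm property computes these residues: starting from the
   empty set, only ascents a_i a_(i+1) .. a_k and words a_(l+1) a_l occur. If l
   is the last letter, there is at most one ascent for each initial letter
   i < l, and those letters i form an interval ending at l - 1, so a state is a
   stack recording where these ascents end, together with l and with the end e
   of the ascent that starts at l + 1. Reading a letter pushes on or pops from
   this stack.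

   Read from the top, the reachable stacks with e = l are coded by the words over
   three letters (D lowers the level that V pushes as end of an ascent, X pushes
   an ascent of length one) in which no X directly follows a D; there are
   fib (2 k + 2) such words of length k. The stacks with e > l are coded by such
   a word of length k < n - 1 and a pair (g, b) with g + b < n - 1 - k. *)
Require Import Defs.
From mathcomp Require Import all_boot all_order.
From mathcomp Require Import zify.
From mathcomp Require Import boolp classical_sets functions cardinality.
From Stdlib Require Import Setoid Morphisms.
Set Implicit Arguments.
Unset Strict Implicit.
Unset Printing Implicit Defensive.
Import Order.TTheory.
Local Open Scope nat_scope.

(** * Divisibility in the braid monoid *)

Definition far (i j : nat) := (i.+1 < j) || (j.+1 < i).
Definition near (i j : nat) := (i.+1 == j) || (j.+1 == i).

Lemma far_sym i j : far i j = far j i. Proof. by rewrite /far orbC. Qed.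
Lemma near_sym i j : near i j = near j i. Proof. by rewrite /near orbC. Qed.

#[local] Instance braid_eq_equivalence n : Equivalence (@braid_eq n).
Proof.
split=> [u|u v|u v w]; [exact: braid_eq_refl|exact: braid_eq_sym|].
exact: braid_eq_trans.
Qed.

#[local] Instance cons_braid_eq n (i : 'I_n) :
  Proper (@braid_eq n ==> @braid_eq n) (cons i).
Proof. by move=> u v /(braid_eq_ctx [:: i] [::]); rewrite !cats0. Qed.

#[local] Instance cat_braid_eq n :
  Proper (@braid_eq n ==> @braid_eq n ==> @braid_eq n) (@cat 'I_n).
Proof.
move=> u v uv u' v' uv'; transitivity (v ++ u').
  exact: (braid_eq_ctx [::] u' uv).
by have := braid_eq_ctx v [::] uv'; rewrite !cats0.
Qed.

#[local] Hint Resolve braid_eq_refl : core.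

Local Notation "u ~~ v" := (braid_eq u v) (at level 70, no associativity).

Lemma far_swap n (i j : 'I_n) u : far i j -> i :: j :: u ~~ j :: i :: u.
Proof. by move=> ij; apply: (@braid_eq_far n [::]); rewrite /far in ij; lia. Qed.

Lemma near_braid n (i j : 'I_n) u :
  near i j -> i :: j :: i :: u ~~ j :: i :: j :: u.
Proof. by move=> ij; apply: (@braid_eq_near n [::]); rewrite /near in ij; lia. Qed.

(** * Garside's lcm property for pairs of generators *)

Definition lcm_split n (i j : 'I_n) (u v : word n) : Prop :=
  [\/ i = j /\ u ~~ v,
      far i j /\ exists2 z, u ~~ j :: z & v ~~ i :: z
    | near i j /\ exists2 z, u ~~ j :: i :: z & v ~~ i :: j :: z].

Lemma lcm_split_sym n (i j : 'I_n) u v : lcm_split i j u v -> lcm_split j i v u.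
Proof.
case=> [[-> uv]|[ij [z uz vz]]|[ij [z uz vz]]].
- by apply: Or31; split=> //; symmetry.
- by apply: Or32; rewrite far_sym; split=> //; exists z.
- by apply: Or33; rewrite near_sym; split=> //; exists z.
Qed.

Lemma lcm_split_cong n (i j : 'I_n) u u' v v' :
  u ~~ u' -> v ~~ v' -> lcm_split i j u v -> lcm_split i j u' v'.
Proof.
move=> uu vv [[-> uv]|[ij [z uz vz]]|[ij [z uz vz]]].
- by apply: Or31; split=> //; rewrite -uu -vv.
- by apply: Or32; split=> //; exists z; rewrite -?uu -?vv.
- by apply: Or33; split=> //; exists z; rewrite -?uu -?vv.
Qed.

Lemma ord_cases n (i j : 'I_n) : [\/ i = j, far i j | near i j].
Proof.
case: (ltngtP i j) => [ij|ji|/val_inj ij]; last exact: Or31.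
- case: (ltngtP i.+1 j) => [h|h|h].
  + by apply: Or32; rewrite /far h.
  + by move: h; rewrite ltnS leqNgt ij.
  + by apply: Or33; rewrite /near h eqxx.
- case: (ltngtP j.+1 i) => [h|h|h].
  + by apply: Or32; rewrite /far h orbT.
  + by move: h; rewrite ltnS leqNgt ji.
  + by apply: Or33; rewrite /near h eqxx orbT.
Qed.

Lemma far_irr i : far i i = false. Proof. rewrite /far; lia. Qed.
Lemma near_irr i : near i i = false. Proof. rewrite /near; lia. Qed.
Lemma farNnear i j : far i j -> near i j = false.
Proof. rewrite /far /near; lia. Qed.
Lemma near_triangle i j k : near i j -> near j k -> near i k = false.
Proof. rewrite /near; lia. Qed.

Section Trans.
Variables (n m : nat).
Hypothesis IH : forall (i j : 'I_n) u v, size u < m ->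
  i :: u ~~ j :: v -> lcm_split i j u v.

Lemma split_eq (i : 'I_n) u v : size u < m -> i :: u ~~ i :: v -> u ~~ v.
Proof.
move=> um /(IH um) [[]//|[]|[]]; first by rewrite far_irr.
by rewrite near_irr.
Qed.

Lemma split_far (i j : 'I_n) u v : size u < m -> far i j ->
  i :: u ~~ j :: v -> exists2 z, u ~~ j :: z & v ~~ i :: z.
Proof.
move=> um ij /(IH um) [[eij]|[]//|[nij]].
  by rewrite eij far_irr in ij.
by rewrite farNnear in nij.
Qed.

Lemma split_near (i j : 'I_n) u v : size u < m -> near i j ->
  i :: u ~~ j :: v -> exists2 z, u ~~ j :: i :: z & v ~~ i :: j :: z.
Proof.
move=> um ij /(IH um) [[eij]|[fij]|[]//].
  by rewrite eij near_irr in ij.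
by rewrite farNnear in ij.
Qed.

(** In the nontrivial cases both splittings factor [w]. The two factorizations are compared by the
    property for shorter words, and the common tail so obtained is put back with braid moves. The
    cases are the mutual positions of [i], [k] and [j]. *)
Lemma lcm_split_trans (i j k : 'I_n) u v w : size u = m ->
  lcm_split i k u w -> lcm_split k j w v -> lcm_split i j u v.
Proof.
move=> um [[-> uw]|[ik [z uz wz]]|[ik [z uz wz]]].
- by apply: lcm_split_cong => //; symmetry.
- have sz := braid_eq_size uz; rewrite /= um in sz.
  have swz := braid_eq_size wz; rewrite /= in swz.
  case=> [[<- wv]|[kj [z' wz' vz']]|[kj [z' wz' vz']]].
  + apply: Or32; split=> //; exists z => //; by rewrite -wv.
  + have E : i :: z ~~ j :: z' by rewrite -wz.
    case: (ord_cases i j) => ij.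
    * subst j; apply: Or31; split=> //.
      rewrite uz vz'; apply: cons_braid_eq; apply: split_eq E; lia.
    * have [|t zt zt'] := split_far _ ij E; first lia.
      apply: Or32; split=> //; exists (k :: t).
        by rewrite uz zt far_swap.
      by rewrite vz' zt' far_swap // far_sym.
    * have [|t zt zt'] := split_near _ ij E; first lia.
      apply: Or33; split=> //; exists (k :: t).
        by rewrite uz zt far_swap // (@far_swap _ k i) // far_sym.
      by rewrite vz' zt' (@far_swap _ k i) 1?far_sym // (@far_swap _ k j).
  + have E : i :: z ~~ j :: k :: z' by rewrite -wz.
    case: (ord_cases i j) => ij.
    * by move: kj; rewrite -ij near_sym farNnear.
    * have [|t zt /= zt'] := split_far _ ij E; first lia.
      have stt := braid_eq_size zt; rewrite /= in stt.
      have szt' := braid_eq_size zt'; rewrite /= in szt'.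
      have [||s zs ts] := @split_far k i z' t _ _ zt'; [lia|by rewrite far_sym|].
      apply: Or32; split=> //; exists (k :: j :: s).
        by rewrite uz zt ts near_braid.
      rewrite vz' zs (@far_swap _ j i) 1?far_sym //.
      by rewrite (@far_swap _ k i) // far_sym.
    * have [|t zt zt'] := split_near _ ij E; first lia.
      have stt := braid_eq_size zt; rewrite /= in stt.
      have szt' := braid_eq_size zt'; rewrite /= in szt'.
      have [||s zs ts] := @split_far k i z' (j :: t) _ _ zt';
        [lia|by rewrite far_sym|].
      have sts := braid_eq_size ts; rewrite /= in sts.
      have [||r tr sr] := @split_near j k t s _ _ ts; [lia|by rewrite near_sym|].
      have jk : near j k by rewrite near_sym.
      have ki : far k i by rewrite far_sym.
      apply: Or33; split=> //; exists (k :: j :: i :: r).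
        rewrite uz zt tr (@far_swap _ i k (j :: r)) //.
        rewrite (@near_braid _ k j (i :: j :: r)) //.
        by rewrite (@near_braid _ j i r) 1?near_sym // (@far_swap _ k i (j :: i :: r)).
      rewrite vz' zs sr (@near_braid _ j i (k :: r)) 1?near_sym //.
      rewrite (@far_swap _ k i (j :: i :: k :: r)) //.
      by rewrite (@far_swap _ i k r) // (@near_braid _ k j (i :: r)).
- have sz := braid_eq_size uz; rewrite /= um in sz.
  have swz := braid_eq_size wz; rewrite /= in swz.
  case=> [[<- wv]|[kj [z' wz' vz']]|[kj [z' wz' vz']]].
  + apply: Or33; split=> //; exists z => //; by rewrite -wv.
  + have E : j :: z' ~~ i :: k :: z by rewrite -wz -wz'.
    have := braid_eq_size E; rewrite /= => sE.
    case: (ord_cases j i) => ij.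
    * by move: kj; rewrite ij far_sym => /farNnear; rewrite ik.
    * have [|t zt /= zt'] := split_far _ ij E; first lia.
      have stt := braid_eq_size zt; rewrite /= in stt.
      have szt' := braid_eq_size zt'; rewrite /= in szt'.
      have [||s zs ts] := @split_far k j z t _ _ zt'; [lia|by []|].
      apply: Or32; rewrite far_sym; split=> //; exists (k :: i :: s).
        rewrite uz zs (@far_swap _ i j) 1?far_sym //.
        by rewrite (@far_swap _ k j).
      by rewrite vz' zt ts near_braid // near_sym.
    * have [|t zt zt'] := split_near _ ij E; first lia.
      have stt := braid_eq_size zt; rewrite /= in stt.
      have szt' := braid_eq_size zt'; rewrite /= in szt'.
      have [||s zs ts] := @split_far k j z (i :: t) _ _ zt'; [lia|by []|].
      have sts := braid_eq_size ts; rewrite /= in sts.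
      have [||r tr sr] := @split_near i k t s _ _ ts; [lia|by []|].
      have ji : near i j by rewrite near_sym.
      have ki : near k i by rewrite near_sym.
      have jk : far j k by rewrite far_sym.
      apply: Or33; split=> //; exists (k :: i :: j :: r).
        rewrite uz zs sr (@near_braid _ i j (k :: r)) // (@far_swap _ j k r) //.
        by rewrite (@far_swap _ k j (i :: k :: j :: r)) // (@near_braid _ k i (j :: r)).
      rewrite vz' zt tr (@far_swap _ j k (i :: r)) // (@near_braid _ k i (j :: i :: r)) //.
      by rewrite (@near_braid _ i j r) // (@far_swap _ k j (i :: j :: r)).
  + have E : i :: k :: z ~~ j :: k :: z' by rewrite -wz.
    have sE := braid_eq_size E; rewrite /= in sE.
    case: (ord_cases i j) => ij.
    * subst j; apply: Or31; split=> //.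
      have {}E : k :: z ~~ k :: z' by apply: split_eq E; rewrite /=; lia.
      rewrite uz vz'; do 2! apply: cons_braid_eq; apply: split_eq E; lia.
    * have [|t zt zt'] := split_far _ ij E; first (rewrite /=; lia).
      have [|s zs ts] := split_near _ kj zt; first lia.
      have ki : near k i by rewrite near_sym.
      have jk : near j k by rewrite near_sym.
      have [|s' zs' ts'] := split_near _ ki zt'; first lia.
      have sts := braid_eq_size ts; rewrite /= in sts.
      have szs := braid_eq_size zs; rewrite /= in szs.
      have {}ts' : j :: s ~~ i :: s'.
        apply: (@split_eq k); first (rewrite /=; lia).
        by rewrite -ts -ts'.
      have ji : far j i by rewrite far_sym.
      have [|r sr sr'] := split_far _ ji ts'; first lia.
      apply: Or32; split=> //; exists (k :: i :: j :: k :: r).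
        rewrite uz zs sr (@far_swap _ i j (k :: i :: r)) // (@near_braid _ i k r) //.
        by rewrite (@near_braid _ k j (i :: k :: r)) // (@far_swap _ j i (k :: r)).
      rewrite vz' zs' sr' (@far_swap _ j i (k :: j :: r)) // (@near_braid _ j k r) //.
      by rewrite (@near_braid _ k i (j :: k :: r)).
    * by have := near_triangle ik kj; rewrite ij.
Qed.
End Trans.

Lemma garside n (i j : 'I_n) u v : i :: u ~~ j :: v -> lcm_split i j u v.
Proof.
have [m] := ubnP (size u); elim: m i j u v => // m IH i j u v.
rewrite ltnS leq_eqVlt => /predU1P[um|]; last exact: IH.
(* Inside the induction on length runs an induction on the derivation of the equivalence; only
   transitivity calls on shorter words. *)
suff gen (x y : word n) : x ~~ y -> forall (i j : 'I_n) u v, size u = m ->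
    x = i :: u -> y = j :: v -> lcm_split i j u v.
  by move=> E; apply: gen E _ _ _ _ um erefl erefl.
elim=> {i j u v um x y} [x|x y xy ih|x y z xy ih1 yz ih2|p q a b ab|p q a b ab] i j u v um.
- by move=> -> [-> ->]; apply: Or31.
- move=> yi xj; apply: lcm_split_sym; apply: ih => //.
  by move: (braid_eq_size xy); rewrite yi xj /= um => -[].
- move=> xi zj; case: y xy yz ih1 ih2 => [|k w] xy yz ih1 ih2.
    by move: (braid_eq_size xy); rewrite xi.
  apply: (lcm_split_trans IH um (ih1 _ _ _ _ um xi erefl)).
  apply: ih2 => //.
  by move: (braid_eq_size xy); rewrite xi /= um => -[].
- case: p => [|c p] [<- <-] [<- <-].
    apply: Or32; split; first by rewrite /far; lia.
    by exists q.
  by apply: Or31; split=> //; apply: braid_eq_far.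
- case: p => [|c p] [<- <-] [<- <-].
    apply: Or33; split; first by rewrite /near; lia.
    by exists q.
  by apply: Or31; split=> //; apply: braid_eq_near.
Qed.

(** * Left divisibility and residues by one letter *)

Definition ldiv n (u w : word n) : Prop := exists z, w ~~ u ++ z.

#[local] Instance ldiv_braid_eq n :
  Proper (@braid_eq n ==> @braid_eq n ==> iff) (@ldiv n).
Proof.
move=> u u' uu w w' ww; split=> -[z wz]; exists z.
  by rewrite -ww wz uu.
by rewrite ww wz uu.
Qed.

Lemma ldiv_refl n (u : word n) : ldiv u u.
Proof. by exists [::]; rewrite cats0. Qed.

Lemma ldiv_nil n (u : word n) : ldiv [::] u.
Proof. by exists u. Qed.

Lemma ldiv_trans n (u v w : word n) : ldiv u v -> ldiv v w -> ldiv u w.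
Proof. by move=> [z vz] [t wt]; exists (z ++ t); rewrite wt vz catA. Qed.

Lemma ldiv_catr n (u v w : word n) : ldiv u v -> ldiv u (v ++ w).
Proof. by move=> /ldiv_trans; apply; exists w. Qed.

Lemma ldiv_catl n (u v w : word n) : ldiv (u ++ v) w -> ldiv u w.
Proof. by apply: ldiv_trans; exists v. Qed.

Lemma ldiv_size n (u v : word n) : ldiv u v -> size u <= size v.
Proof. by case=> z /braid_eq_size ->; rewrite size_cat leq_addr. Qed.

Lemma braid_eq_mem n (u v : word n) : u ~~ v -> u =i v.
Proof.
elim=> {u v} [//|u v _ + x|u v w _ uv _ vw x|u v i j _ x|u v i j _ x].
- by move=> ->.
- by rewrite uv vw.
- by rewrite !mem_cat !inE; do !case: (_ == _); rewrite ?orbT.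
- by rewrite !mem_cat !inE; do !case: (_ == _); rewrite ?orbT.
Qed.

Lemma ldiv_mem n (u v : word n) : ldiv u v -> {subset u <= v}.
Proof. by move=> [z /braid_eq_mem vz] x xu; rewrite vz mem_cat xu. Qed.

Lemma braid_eq_cancel n (i : 'I_n) u v : i :: u ~~ i :: v -> u ~~ v.
Proof.
by move=> /garside [[]//|[]|[]]; rewrite ?far_irr ?near_irr.
Qed.

Lemma ldiv_cons n (i : 'I_n) u w : ldiv (i :: u) (i :: w) <-> ldiv u w.
Proof.
split=> [[z /braid_eq_cancel wz]|[z wz]]; exists z => //.
by rewrite wz.
Qed.

(** Here and in [ldiv_near], [w] must first supply what the lcm of [i] and [j] has beyond [j]; then
    [u] has to divide what that lcm has beyond [i], followed by the rest [y]. *)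
Lemma ldiv_far n (i j : 'I_n) u w : far i j ->
  ldiv (i :: u) (j :: w) <-> exists2 y, w ~~ i :: y & ldiv u (j :: y).
Proof.
move=> ij; split=> [[z]|[y wy [z yz]]].
  rewrite cat_cons => /garside [[eij]|[_ [y wy uy]]|[/=]].
  - by rewrite eij far_irr in ij.
  - by exists y => //; exists z; symmetry.
  - by rewrite near_sym farNnear.
by exists z; rewrite wy far_swap 1?far_sym // yz.
Qed.

Lemma ldiv_near n (i j : 'I_n) u w : near i j ->
  ldiv (i :: u) (j :: w) <-> exists2 y, w ~~ i :: j :: y & ldiv u (j :: i :: y).
Proof.
move=> ij; split=> [[z]|[y wy [z yz]]].
  rewrite cat_cons => /garside [[eij]|[/=]|[_ [y wy uy]]].
  - by rewrite eij near_irr in ij.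
  - by rewrite far_sym => /farNnear; rewrite ij.
  - by exists y => //; exists z; symmetry.
by exists z; rewrite wy (@near_braid _ j i) 1?near_sym // yz.
Qed.

Lemma ldiv_all_far n (u : word n) (j : 'I_n) w : {in u, forall i : 'I_n, far i j} ->
  ldiv u (j :: w) <-> ldiv u w.
Proof.
elim: u w => [|i u IH] w uj; first by split=> _; exact: ldiv_nil.
have ij : far i j by apply: uj; rewrite mem_head.
have {}IH v : ldiv u (j :: v) <-> ldiv u v.
  by apply: IH => x xu; apply: uj; rewrite inE xu orbT.
rewrite (ldiv_far _ _ ij); split=> [[y wy /IH [z yz]]|[z wz]].
  by exists z; rewrite wy yz.
by exists (u ++ z) => //; apply/IH; exists z.
Qed.

Lemma ldiv_all_far1 n (i j : 'I_n) w : far i j ->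
  ldiv [:: i] (j :: w) <-> ldiv [:: i] w.
Proof.
by move=> ij; apply: ldiv_all_far => x; rewrite inE => /eqP ->.
Qed.

Lemma ldiv_near1 n (i j : 'I_n) w : near i j ->
  ldiv [:: i] (j :: w) <-> ldiv [:: i; j] w.
Proof.
move=> ij; rewrite (ldiv_near _ _ ij); split=> [[y wy _]|[y wy]]; exists y => //.
exact: ldiv_nil.
Qed.

Lemma ldiv_near2 n (i j : 'I_n) w : near i j ->
  ldiv [:: i; j] (j :: w) <-> ldiv [:: i; j] w.
Proof.
move=> ij; rewrite (ldiv_near _ _ ij); split=> [[y wy _]|[y wy]]; exists y => //.
by apply/ldiv_cons; exact: ldiv_nil.
Qed.

(** Runs are handled as words of natural numbers, where their ends obey linear arithmetic; [inord]
    is faithful on the letters up to [N]. *)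
Definition letters N (s : seq nat) : word N.+1 := map inord s.

Definition ascent i k := iota i (k.+1 - i).

Lemma ascent_cons i k : i <= k -> ascent i k = i :: ascent i.+1 k.
Proof. by move=> ik; rewrite /ascent subSS subSn. Qed.

Lemma ascent1 i : ascent i i = [:: i].
Proof. by rewrite ascent_cons // /ascent subnn. Qed.

Lemma mem_ascent i k x : (x \in ascent i k) = (i <= x <= k).
Proof. by rewrite mem_iota; lia. Qed.

(** * Ascents: their residues by a letter and their first letters *)

Section Residues.
Variables (N : nat).
Implicit Types (j : 'I_N.+1) (w y : word N.+1).

Lemma ldiv_ascent_far i k j w : k <= N -> (k.+1 < j) || (j.+1 < i) ->
  ldiv (letters N (ascent i k)) (j :: w) <-> ldiv (letters N (ascent i k)) w.
Proof.
move=> kN kj; apply: ldiv_all_far => x /mapP [m]; rewrite mem_ascent => mik ->.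
by rewrite /far inordK; lia.
Qed.

Lemma ldiv_ascent_start k j w : j <= k ->
  ldiv (letters N (ascent j k)) (j :: w) <-> ldiv (letters N (ascent j.+1 k)) w.
Proof. by move=> jk; rewrite ascent_cons //= inord_val ldiv_cons. Qed.

(* Since [a_j (a_i .. a_k) = (a_i .. a_k) a_(j-1)] for [i < j <= k], such a run
   is its own residue; for [j = k + 1] the run is prolonged by one letter. *)
Lemma ldiv_ascent_mid i k j w : i < j -> i <= k -> j <= k.+1 -> k <= N ->
  ldiv (letters N (ascent i k)) (j :: w) <->
    ldiv (letters N (ascent i (maxn j k))) w.
Proof.
move=> + ik jk kN; have [m] := ubnP (j - i).
elim: m i ik w => // m IH i ik w ijm ij.
rewrite ascent_cons //= [ascent i (maxn j k)]ascent_cons ?leq_max ?ik ?orbT //=.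
have [eij|ij1] := eqVneq i.+1 j; last first.
  have ij2 : i.+1 < j by lia.
  have fij : far (inord i : 'I_N.+1) j by rewrite /far inordK; lia.
  rewrite (ldiv_far _ _ fij); split=> [[y wy]|].
    rewrite IH ?wy ?ldiv_cons //; lia.
  move=> [z wz]; exists (letters N (ascent i.+1 (maxn j k)) ++ z) => //.
  by apply/IH; [lia|lia|lia|exists z].
have nij : near (inord i : 'I_N.+1) j by rewrite /near inordK; lia.
rewrite (ldiv_near _ _ nij) eij [ascent j (maxn j k)]ascent_cons ?leq_maxl //= inord_val.
have -> : ascent j.+1 (maxn j k) = ascent j.+1 k by rewrite /ascent;
  congr iota; lia.
have key y : ldiv (letters N (ascent j k)) (j :: inord i :: y) <->
    ldiv (letters N (ascent j.+1 k)) y.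
  have [kj|jk'] := ltnP k j.
    have -> : ascent j k = [::] by rewrite /ascent (_ : k.+1 - j = 0) //; lia.
    have -> : ascent j.+1 k = [::] by rewrite /ascent (_ : k.+1 - j.+1 = 0) //; lia.
    by split=> _; exact: ldiv_nil.
  rewrite ldiv_ascent_start // ldiv_ascent_far //.
  by rewrite inordK; lia.
split=> [[y wy /key yd]|[z wz]].
  by rewrite wy !ldiv_cons.
by exists (letters N (ascent j.+1 k) ++ z) => //; apply/key; exists z.
Qed.

(** A divisor far from [i] would divide the rest of the ascent, hence be [i + 1] by induction, which
    is not far from [i]. A near one would require [i] to occur again in the rest. *)
Lemma ldiv_ascent_first i k (j : 'I_N.+1) : i <= k <= N ->
  ldiv [:: j] (letters N (ascent i k)) -> j = i :> nat.
Proof.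
have [m] := ubnP (k - i); elim: m i => // m IH i km /andP [ik kN].
rewrite ascent_cons //=; case: (ord_cases j (inord i)) => ji.
- by rewrite ji inordK //; lia.
- rewrite ldiv_all_far1 // => jd.
  have [kE|ik'] := eqVneq i k.
    by move/ldiv_size: jd; rewrite kE /ascent subnn.
  have := IH i.+1 _ _ jd; move: ji; rewrite /far inordK; lia.
- rewrite ldiv_near1 // => jd.
  have ji1 : j = i.+1 :> nat.
    have := ldiv_mem jd (mem_head _ _) => /mapP [x]; rewrite mem_ascent => xik jx.
    move: ji; rewrite /near jx !inordK; lia.
  have ik' : i < k.
    by move: (ldiv_size jd); rewrite /= size_map size_iota; lia.
  move: jd; rewrite ascent_cons //= -ji1 inord_val ldiv_cons.
  move/ldiv_mem/(_ _ (mem_head _ _))/mapP => [x]; rewrite mem_ascent => xk.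
  by move/(congr1 val); rewrite /= !inordK; lia.
Qed.

Lemma ldiv_desc_first i (j : 'I_N.+1) : i < N ->
  ldiv [:: j] (letters N [:: i.+1; i]) -> j = i.+1 :> nat.
Proof.
move=> iN /=; case: (ord_cases j (inord i.+1)) => ji.
- by rewrite ji inordK.
- rewrite ldiv_all_far1 // => /ldiv_mem/(_ _ (mem_head _ _)).
  by rewrite inE => /eqP je; move: ji; rewrite je /far !inordK; lia.
- by rewrite ldiv_near1 // => /ldiv_size.
Qed.

End Residues.

(** * Greatest representatives *)

Section MaxRep.
Variable n : nat.
Implicit Types (i j : 'I_n) (u v w x y : word n).

Fixpoint lexmax w : Prop :=
  if w is i :: v then (forall j, ldiv [:: j] w -> j <= i) /\ lexmax v else True.

(** The part of [lexmax (x ++ y)] that concerns the suffixes starting inside [x]. It depends on [y]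
    only through its braid, as a notion of forbidden braid requires. *)
Fixpoint admits x y : Prop :=
  if x is i :: x' then (forall j, ldiv [:: j] (x ++ y) -> j <= i) /\ admits x' y
  else True.

Lemma lexmax_cat x y : lexmax (x ++ y) <-> admits x y /\ lexmax y.
Proof.
elim: x => [|i x IH] /=; first by split=> [|[]].
by rewrite IH; split=> [[? [? ?]]|[[? ?] ?]].
Qed.

Lemma admits_rcons x j y :
  admits (rcons x j) y <->
    admits x (j :: y) /\ (forall k, ldiv [:: k] (j :: y) -> k <= j).
Proof.
elim: x => [|i x IH] /=; first by split=> [[]|[]].
by rewrite IH cat_rcons; split=> [[? [? ?]]|[[? ?] ?]].
Qed.

Lemma admits_ldiv x u v : ldiv u v -> admits x v -> admits x u.
Proof.
move=> uv; elim: x => //= i x IH [xi /IH ?]; split=> // j ju; apply: xi.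
case: uv => z vz.
by move: (ldiv_catr z ju); rewrite /= -catA -vz.
Qed.

Lemma admits_nil x : lexmax x -> admits x [::].
Proof. by rewrite -{1}[x]cats0 lexmax_cat => -[]. Qed.

Lemma lex_le_cons i j u v :
  lex_le (i :: u) (j :: v) = (i <= j) && ((j <= i) ==> lex_le u v).
Proof. by []. Qed.

Lemma lex_le_anti u v : lex_le u v -> lex_le v u -> u = v.
Proof. by move=> uv vu; apply: (@le_anti _ (seqlexi 'I_n)); apply/andP. Qed.

(** A greater representative has either a greater first letter, which then divides the word, or the
    same one, which can be cancelled. *)
Lemma lexmaxP w : lexmax w <-> forall v, v ~~ w -> lex_le v w.
Proof.
elim: w => [|i w IH].
  by split=> // _ v /braid_eq_size; case: v.
split=> [[wi /IH gw] [|j v] vw|wmax /=].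
- by move/braid_eq_size: vw.
- have ji : j <= i by apply: wi; exists v; symmetry.
  rewrite lex_le_cons ji; apply/implyP => ij.
  have {ij ji}eji : j = i by apply: val_inj; apply/eqP; rewrite eqn_leq ji.
  by apply: gw; apply: braid_eq_cancel (i) _ _ _; rewrite -{1}eji.
- split=> [j [z wz]|].
    have /wmax : [:: j] ++ z ~~ i :: w by symmetry.
    by rewrite lex_le_cons => /andP[].
  apply/IH => v vw.
  have /wmax : i :: v ~~ i :: w by rewrite vw.
  by rewrite lex_le_cons leqnn.
Qed.

Lemma max_repE (b : braid n) w : max_rep b = w <-> eval w = b /\ lexmax w.
Proof.
have [eb bmax] := max_repP b; split=> [<-|[ew /lexmaxP gw]].
  by split=> //; apply/lexmaxP => v /eval_eq; rewrite eb; exact: bmax.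
apply: lex_le_anti; last exact: bmax.
by apply: gw; apply/eval_eq; rewrite ew.
Qed.

Lemma lexmax_max_rep (b : braid n) : lexmax (max_rep b).
Proof. by have [] := (max_repE b _).1 erefl. Qed.

Lemma eval_max_rep (b : braid n) : eval (max_rep b) = b.
Proof. by case: (max_repP b). Qed.

Lemma max_langE : max_lang n = [set w | lexmax w]%classic.
Proof.
apply/seteqP; split=> [w [b _ <-]|w gw]; first exact: lexmax_max_rep.
by exists (eval w) => //; exact/max_repE.
Qed.

Lemma evalM u v : eval (u ++ v) = (eval u * eval v)%g.
Proof. exact: eval_cat. Qed.

Lemma braid_prefix_ldiv u v : braid_prefix (eval u) (eval v) <-> ldiv u v.
Proof.
split=> [[d]|[z vz]].
  by rewrite -(eval_repr d) -evalM => /eval_eq vd; exists (repr d).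
by exists (eval z); rewrite -evalM; apply/eval_eq.
Qed.

Lemma max_rep_mulE x y : lexmax x ->
  max_rep (eval x * eval y)%g = max_rep (eval x) ++ max_rep (eval y) <-> admits x y.
Proof.
move=> gx; have -> : max_rep (eval x) = x by apply/max_repE.
have yy : max_rep (eval y) ~~ y by apply/eval_eq; rewrite eval_max_rep.
rewrite max_repE lexmax_cat; split=> [[_ [+ _]]|oxy].
  by apply: admits_ldiv; rewrite yy; exact: ldiv_refl.
split; first by rewrite evalM eval_max_rep.
split; last exact: lexmax_max_rep.
by apply: admits_ldiv oxy; rewrite yy; exact: ldiv_refl.
Qed.

Lemma lexmax_rcons x j : lexmax (rcons x j) <-> lexmax x /\ admits x [:: j].
Proof.
rewrite -cats1 lexmax_cat; split=> [[xj _]|[_ xj]].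
  split=> //; rewrite -[x]cats0 lexmax_cat; split=> //.
  by apply: admits_ldiv xj; exact: ldiv_nil.
split=> //; split=> // k /ldiv_mem/(_ _ (mem_head _ _)).
by rewrite inE => /eqP ->.
Qed.

Lemma forbidden_prefixesP x y : lexmax x ->
  forbidden_prefixes (eval x) (eval y) <->
  ~ admits x y /\ forall z, ~ admits x z -> ldiv z y -> z ~~ y.
Proof.
move=> gx; rewrite /forbidden_prefixes /minimal_prefixes /=.
split=> [[xy ymin]|[xy ymin]]; split.
- by move=> oxy; apply: xy; apply/max_rep_mulE.
- move=> z xz zy; apply/eval_eq; apply: ymin; last exact/braid_prefix_ldiv.
  by by move/(max_rep_mulE _ gx).
- by by move/(max_rep_mulE _ gx).
- move=> c; rewrite -(eval_repr c) => xc /braid_prefix_ldiv cy.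
  apply/eval_eq; apply: ymin => //.
  by move=> oxc; apply: xc; apply/max_rep_mulE.
Qed.

(** Descent to a minimal divisor ends because a divisor that is not equivalent to the word is
    shorter. *)
Lemma forbidden_below x y : lexmax x -> ~ admits x y ->
  exists2 z, forbidden_prefixes (eval x) (eval z) & ldiv z y.
Proof.
move=> gx; have [m] := ubnP (size y); elim: m y => // m IH y ym xy.
have [[z [xz zy nzy]]|noz] :=
  pselect (exists z, [/\ ~ admits x z, ldiv z y & ~ z ~~ y]).
  have zm : size z < m.
    case: zy => -[|i t] yt; first by case: nzy; rewrite yt cats0.
    by move: (braid_eq_size yt); rewrite size_cat /=; lia.
  have [t xt tz] := IH z zm xz.
  by exists t => //; exact: ldiv_trans zy.
exists y; last exact: ldiv_refl.
apply/forbidden_prefixesP => //; split=> // z xz zy.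
by apply: contrapT => nzy; apply: noz; exists z.
Qed.

Lemma forbidden_gen x j : lexmax x ->
  forbidden_prefixes (eval x) (gen j) <-> ~ admits x [:: j].
Proof.
move=> gx; rewrite /gen forbidden_prefixesP //; split=> [[]//|xj]; split=> //.
move=> z xz zj; have := ldiv_size zj; case: z zj xz => [|i [|//]] zj xz _.
  by case: xz; exact: admits_nil.
by have := ldiv_mem zj (mem_head _ _); rewrite inE => /eqP ->.
Qed.

Lemma admits_forbidden x y : lexmax x ->
  admits x y <-> ~ exists2 z, forbidden_prefixes (eval x) (eval z) & ldiv z y.
Proof.
move=> gx; split=> [xy [z /(forbidden_prefixesP _ gx)[xz _] zy]|nz].
  by apply: xz; apply: admits_ldiv xy.
by apply: contrapT => /(forbidden_below gx).
Qed.

Lemma forbidden_step x x' j : lexmax x -> lexmax x' ->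
  forbidden_prefixes (eval x) = forbidden_prefixes (eval x') ->
  admits x [:: j] ->
  forbidden_prefixes (eval (rcons x j)) = forbidden_prefixes (eval (rcons x' j)).
Proof.
move=> gx gx' xx' xj.
have okE y : admits x y <-> admits x' y by rewrite !admits_forbidden // xx'.
have gxj : lexmax (rcons x j) by apply/lexmax_rcons.
have gxj' : lexmax (rcons x' j) by apply/lexmax_rcons; rewrite -okE.
apply/seteqP; split=> y; rewrite -(eval_repr y) !forbidden_prefixesP //;
  rewrite !admits_rcons okE => -[xy ymin]; (split=> // z);
  by have := ymin z; rewrite !admits_rcons okE.
Qed.

Lemma run_Gamma x w : lexmax x ->
  run (M := Gamma n) (forbidden_prefixes (eval x)) w <-> lexmax (x ++ w).
Proof.
elim: w x => [|j w IH] x gx /=; first by rewrite cats0.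
rewrite -cat_rcons; split=> [[_ [b [xb bj ->]]]|gxjw].
  (* The arrow may be given by another braid [b] with the same state; [forbidden_step] exchanges it
     for [x]. *)
  have [gb eb] := (lexmax_max_rep b, eval_max_rep b).
  have xj : admits x [:: j].
    by apply: contrapT => /(forbidden_gen _ gx); rewrite xb.
  have gxj : lexmax (rcons x j) by apply/lexmax_rcons.
  rewrite -eb /gen -evalM cats1 -(forbidden_step gx gb) //; last by rewrite eb.
  by move/IH; apply.
have [xj gw] := (lexmax_cat _ _).1 gxjw.
have gxj : lexmax (rcons x j).
  rewrite -[rcons _ _]cats0 lexmax_cat; split=> //.
  by apply: admits_ldiv xj; exact: ldiv_nil.
exists (forbidden_prefixes (eval (rcons x j))); last exact/IH.
exists (eval x); split=> //; last by rewrite /gen -evalM cats1.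
by have [_ oxj] := (lexmax_rcons _ _).1 gxj; move=> /(forbidden_gen _ gx).
Qed.

Lemma accepted_Gamma : accepted (Gamma n) = max_lang n.
Proof.
rewrite max_langE; apply/seteqP; split=> w; rewrite /accepted /=.
  by move/(@run_Gamma [::] w I).
by move=> gw; apply/(@run_Gamma [::] w I).
Qed.

End MaxRep.

(** * Least representatives, through reversal of the order of the generators *)

Section Reversal.
Variable n : nat.
Implicit Types (u v w : word n).

Definition flip : word n -> word n := map (@rev_ord n).

Lemma flipK : involutive flip.
Proof. exact: mapK (@rev_ordK n). Qed.

Lemma flip_braid_eq u v : u ~~ v -> flip u ~~ flip v.
Proof.
elim=> {u v} [//|u v _ H|u v w _ uv _ vw|u v i j ij|u v i j ij].
- by symmetry.
- by transitivity (flip v).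
- rewrite /flip !map_cat /=; apply: braid_eq_far => /=.
  by move: (ltn_ord i) (ltn_ord j); lia.
- rewrite /flip !map_cat /=; apply: braid_eq_near => /=.
  by move: (ltn_ord i) (ltn_ord j); lia.
Qed.

(** The lengths must agree because a proper prefix stays the smaller word after the flip. *)
Lemma lex_le_flip u v : size u = size v -> lex_le (flip u) (flip v) = lex_le v u.
Proof.
elim: u v => [|i u IH] [|j v] //= [uv]; rewrite !lex_le_cons IH //=.
by move: (ltn_ord i) (ltn_ord j) => ni nj; congr (_ && (_ ==> _)); lia.
Qed.

Lemma min_langE : min_lang n = [set w | lexmax (flip w)]%classic.
Proof.
apply/seteqP; split=> w => [[b _ <-]|/lexmaxP wmin].
  have [eb bmin] := min_repP b; apply/lexmaxP => v vb.
  rewrite -(flipK v) lex_le_flip.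
    apply: bmin; rewrite -eb; apply/eval_eq.
    by rewrite -[X in _ ~~ X]flipK; exact: flip_braid_eq.
  by rewrite (braid_eq_size (flip_braid_eq vb)) flipK.
exists (eval w) => //.
have [/eval_eq ew bmin] := min_repP (eval w).
apply: lex_le_anti; first exact: bmin.
rewrite -lex_le_flip; last exact: braid_eq_size.
by apply: wmin; exact: flip_braid_eq.
Qed.

Lemma run_relabel (A B : Type) (f : A -> B) (g : B ->
  A) (M : automaton A) (q : carrier M)
    (w : seq B) :
  cancel f g -> cancel g f ->
  run (M := relabel f M) q w <-> run (M := M) q (map g w).
Proof.
move=> fK gK; elim: w q => //= b w IH q; split=> -[q'].
  by move=> [a -> qq'] /IH; rewrite fK; exists q'.
by move=> qq' /IH; exists q' => //; exists (g b).
Qed.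

Lemma accepted_Gamma_min : accepted (Gamma_min n) = min_lang n.
Proof.
rewrite min_langE; apply/seteqP; split=> w; rewrite /accepted /=.
  move/(run_relabel _ _ (@rev_ordK n) (@rev_ordK n)).
  by move/(@run_Gamma _ [::] _ I).
move=> gw; apply/(run_relabel _ _ (@rev_ordK n) (@rev_ordK n)).
exact/(@run_Gamma _ [::] _ I).
Qed.

End Reversal.

(** * Residues of the forbidden prefixes *)

(* In [(l, e, s)], with letters numbered from 0 to [N], [l] is the last letter
   read, [s] lists the ends of the ascents with initial letters [l - 1], [l - 2],
   and so on, and [e] is the end of the ascent with initial letter [l + 1], or
   [e = l] if there is none. The empty word behaves like the last letter [N]. *)
Definition config := (nat * nat * seq nat)%type.

(** Here [x] is the end of an ascent that starts below [j]: the residue by [j] is one letter longer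
    exactly when [j] comes right after the end. *)
Definition prolong j x := if x.+1 == j then j else x.

Section Configurations.
Variable N : nat.
Implicit Types (c : config) (i j k l e : nat) (s : seq nat).

Definition start_config : config := (N, N, [::]).

(** A letter is refused when it is itself a forbidden prefix. Reading [l + 1] turns [[:: l.+1; l]]
    into [[:: l]], which is pushed as an ascent of length one. Reading [j <= l] drops the ascents
    starting at [j] or above; the one starting at [j] loses its first letter and so provides the new
    [e]. Putting [l] before [s] and taking [j] as default makes [f = j] when [j = l] or no ascent
    starts at [j]. *)
Definition step c j : option config :=
  let: (l, e, s) := c in
  if l.+1 < j then None
  else if j == l.+1 then
    if e == j then None else Some (j, maxn e j, l :: map (prolong j) s)
  else
    let f := nth j (l :: s) (l - j) in
    if (j < l) && (l - j <= size s) && (f == j) then None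
    else Some (j, f, map (prolong j) (drop (l - j) s)).

(** Besides the recorded ascents, no [k > l] may divide the last letter followed by the prefix. For
    [k > l + 1] this forbids [k] itself, for [k = l + 1] the word [[:: l.+1; l]]. The latter is a
    proper multiple of the ascent at [l + 1] if [e = l + 1], and is listed otherwise. *)
Inductive residual c : seq nat -> Prop :=
| residual_stack i : i < c.1.1 <= i + size c.2 ->
    residual c (ascent i (nth 0 c.2 (c.1.1.-1 - i)))
| residual_desc : c.1.1 < N -> c.1.2 != c.1.1.+1 ->
    residual c [:: c.1.1.+1; c.1.1]
| residual_ascent : c.1.1 < c.1.2 -> residual c (ascent c.1.1.+1 c.1.2)
| residual_top k : c.1.1.+1 < k <= N -> residual c [:: k].

Definition wf_config c : Prop :=
  [/\ c.1.1 <= c.1.2 <= N, size c.2 <= c.1.1 &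
      forall i, i < c.1.1 <= i + size c.2 -> i <= nth 0 c.2 (c.1.1.-1 - i) <= N].

Lemma wf_start : wf_config start_config.
Proof. by split=> //= [|i]; [rewrite leqnn|lia]. Qed.

Lemma nth_prolong j s k : k < size s ->
  nth 0 (map (prolong j) s) k = prolong j (nth 0 s k).
Proof. by move=> ks; rewrite (nth_map 0). Qed.

Lemma prolong_bounds j i x : j <= N -> i <= x <= N -> i <= prolong j x <= N.
Proof. by rewrite /prolong; case: eqP => [<-|]; lia. Qed.

Variant step_spec c j c' : Prop :=
| step_pop of j < c.1.1 <= j + size c.2 & j < c'.1.2
    & c'.1.2 = nth 0 c.2 (c.1.1.-1 - j)
| step_fresh of j <= c.1.1 & c'.1.2 = j & j < c.1.1 -> j + size c.2 < c.1.1
| step_push of j = c.1.1.+1 & c.1.2 != j & c'.1.2 = maxn c.1.2 j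
    & residual c' (ascent c.1.1 c.1.1).

Lemma step_fst c c' j : step c j = Some c' -> c'.1.1 = j.
Proof.
case: c => [[l e] s]; rewrite /step; case: ifP => // _.
by case: ifP => _; case: ifP => // _ [<-].
Qed.

Lemma stepP c c' j : wf_config c -> j <= N -> step c j = Some c' ->
  step_spec c j c'.
Proof.
case: c => [[l e] s] [/= /andP [le eN] sl sN] jN; rewrite /step.
case: ifP => // /negbT; rewrite -leqNgt => jl1.
case: eqP => [jE|jl].
  case: ifP => // /negbT ej [<-]; apply: step_push => //=.
  have := @residual_stack (j, maxn e j, l :: map (prolong j) s) l.
  by rewrite jE /= subnn /=; apply; lia.
case: ifP => // /negbT; set f := nth _ _ _; rewrite !negb_and.
have [jl' /= fj [<-]|lj _ [<-]] := ltnP j l; last first.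
  have lE : l = j by lia.
  by apply: step_fresh => //=; rewrite /f lE ?subnn ?ltnn.
have fE : f = nth j s (l.-1 - j).
  by rewrite /f (_ : l - j = (l.-1 - j).+1) //; lia.
have [ks|ks] := leqP (l - j) (size s); last first.
  apply: step_fresh => /=; [lia| |lia].
  by rewrite fE nth_default //; lia.
rewrite ks /= in fj.
have {}fE : f = nth 0 s (l.-1 - j) by rewrite fE (set_nth_default 0) //; lia.
have := sN j; rewrite -fE => sj.
by apply: step_pop => /=; lia.
Qed.

Lemma step_stack c c' j i : step c j = Some c' -> i < j ->
  i < c.1.1 <= i + size c.2 ->
  j <= i + size c'.2 /\
    nth 0 c'.2 (j.-1 - i) = prolong j (nth 0 c.2 (c.1.1.-1 - i)).
Proof.
case: c => [[l e] s]; rewrite /step /=.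
case: ifP => // /negbT; rewrite -leqNgt => jl1.
case: eqP => [->|jl].
  case: ifP => // _ [<-] /= il ils; rewrite size_map; split; first lia.
  by rewrite (_ : l - i = (l.-1 - i).+1) /= ?nth_prolong //; lia.
case: ifP => // _ [<-] /= ij ils.
rewrite size_map size_drop; split; first lia.
rewrite nth_prolong ?size_drop; last lia.
by rewrite nth_drop (_ : l - j + (j.-1 - i) = l.-1 - i) //; lia.
Qed.

Lemma step_stack_inv c c' j i : step c j = Some c' -> i < j <= i + size c'.2 ->
  i < c.1.1 <= i + size c.2 \/
  [/\ i = c.1.1, j = c.1.1.+1 & nth 0 c'.2 (j.-1 - i) = i].
Proof.
case: c => [[l e] s]; rewrite /step /=.
case: ifP => // /negbT; rewrite -leqNgt => jl1.
case: eqP => [->|jl].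
  case: ifP => // _ [<-] /=; rewrite size_map => il.
  have [->|nil] := eqVneq i l; first by right; rewrite subnn.
  by left; lia.
by case: ifP => // _ [<-] /=; rewrite size_map size_drop => il; left; lia.
Qed.

Lemma wf_step c c' j : wf_config c -> j <= N -> step c j = Some c' -> wf_config c'.
Proof.
move=> wfc jN cc'; have [/andP [le eN] sl sN] := wfc.
have c'j := step_fst cc'.
split; rewrite ?c'j.
- case: (stepP wfc jN cc') => [jl je' e'E|jl -> _|jE _ -> _]; [|lia|lia].
  by have := sN _ jl; rewrite -e'E; lia.
- move: sl cc'; case: (c) => [[l e] s] /= sl; rewrite /step; case: ifP => // _;
    case: eqP => [->|_].
    by case: ifP => // _ [<-] /=; rewrite size_map.
  by case: ifP => // _ [<-] /=; rewrite size_map size_drop; lia.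
- move=> i ij; have [il|[_ _ ->]] := step_stack_inv cc' ij; last lia.
  have ij' : i < j by case/andP: ij.
  by have [_ ->] := step_stack cc' ij' il; apply: prolong_bounds => //; exact: sN.
Qed.

Lemma residual_head c u : wf_config c -> residual c u ->
  exists i v, [/\ u = i :: v & i <= N].
Proof.
case: c => [[l e] s] [/= /andP [le eN] sl sN] [i /= il|/= lN el|/= lte|k /= lk].
- exists i, (ascent i.+1 (nth 0 s (l.-1 - i))); rewrite ascent_cons;
    last by have := sN i il; lia.
  by split=> //; lia.
- by exists l.+1, [:: l].
- by exists l.+1, (ascent l.+2 e); split; [rewrite ascent_cons|lia].
- by exists k, [::]; split=> //; lia.
Qed.

Definition divides_res c (w : word N.+1) : Prop :=
  exists2 u, residual c u & ldiv (letters N u) w.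

Lemma divides_res_next c (w : word N.+1) : c.1.1 < N ->
  ldiv (letters N [:: c.1.1.+1; c.1.1]) w -> divides_res c w.
Proof.
move=> lN lw; have [ec|ec] := eqVneq c.1.2 c.1.1.+1; last first.
  by exists [:: c.1.1.+1; c.1.1] => //; exact: residual_desc.
exists (ascent c.1.1.+1 c.1.2); first by apply: residual_ascent; rewrite ec.
by rewrite ec ascent1;
  exact: (@ldiv_catl _ (letters N [:: c.1.1.+1]) (letters N [:: c.1.1])) lw.
Qed.

Lemma divides_res_larger c (j k : 'I_N.+1) (w : word N.+1) : c.1.1 = j -> j < k ->
  ldiv [:: k] (j :: w) -> divides_res c w.
Proof.
move=> cj jk; have kN := ltn_ord k.
have [kj|kj] := eqVneq (k : nat) j.+1.
  rewrite ldiv_near1 => [kw|]; last by rewrite /near; lia.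
  apply: divides_res_next; first lia.
  by rewrite /= cj -kj !inord_val.
rewrite ldiv_all_far1 => [kw|]; last by rewrite /far; lia.
exists [:: (k : nat)]; last by rewrite /= inord_val.
by apply: residual_top; lia.
Qed.

Lemma ldiv_ascent_prolong i f (j : 'I_N.+1) (w : word N.+1) : i < j ->
  i <= f <= N ->
  ldiv (letters N (ascent i f)) (j :: w) <->
    ldiv (letters N (ascent i (prolong j f))) w.
Proof.
move=> ij /andP [fi fN]; rewrite /prolong; have [fj|fj] := eqVneq f.+1 j.
  by rewrite ldiv_ascent_mid ?(maxn_idPl _) //; lia.
have [fj'|fj'] := ltnP f.+1 j; first by rewrite ldiv_ascent_far // fj'.
by rewrite ldiv_ascent_mid ?(maxn_idPr _) //; lia.
Qed.

(** Mirrors [admits_rcons]: each residual is replaced by its residue by [j], and the letters above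
    [j] contribute [[:: j.+1; j]] and the single letters beyond. Conversely, every residual of [c']
    arises in one of these ways. *)
Lemma divides_res_step c c' (j : 'I_N.+1) (w : word N.+1) :
  wf_config c -> step c j = Some c' ->
  (divides_res c (j :: w) \/ exists2 k : 'I_N.+1, j < k & ldiv [:: k] (j :: w)) <->
  divides_res c' w.
Proof.
move=> wfc cc'; have jN : j <= N := ltn_ord j.
have [/andP [le eN] sl sN] := wfc.
have [/andP [le' eN'] sl' sN'] := wf_step wfc jN cc'.
have c'j := step_fst cc'; rewrite c'j in le' sl' sN'.
split=> [[[u cu uw]|[k jk kw]]|[u cu uw]].
- have [i [v [ui iN]]] := residual_head wfc cu.
  (* A residual starting above [j] is absorbed: its first letter divides [j :: w] and exceeds
     [j]. *)
  have [ji|ij] := ltnP j i.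
    apply: (@divides_res_larger c' j (inord i)) => //; first by rewrite inordK.
    by apply: (@ldiv_catl _ _ (letters N v)); rewrite ui in uw.
  case: cu ui uw => [i' il|lN el|lte|k lk].
  + have si' := sN _ il.
    rewrite ascent_cons; last by case/andP: si'.
    case=> ii' _; rewrite {i'}ii' in il si' *; rewrite -ascent_cons;
      last by case/andP: si'.
    have [eij|nij] := eqVneq i (j : nat).
      rewrite eij in il si' *; rewrite ldiv_ascent_start; last by case/andP: si'.
      case: (stepP wfc jN cc') => [_ je' e'E|jl _ jle|jE]; [|lia|lia].
      rewrite -e'E => uw; exists (ascent j.+1 c'.1.2) => //.
      by rewrite -c'j; apply: residual_ascent; rewrite c'j.
    have {}ij : i < j by rewrite ltn_neqAle nij.
    rewrite ldiv_ascent_prolong // => uw.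
    have [jsz bE] := step_stack cc' ij il.
    exists (ascent i (nth 0 c'.2 (j.-1 - i))); last by rewrite bE.
    by rewrite -c'j; apply: residual_stack; rewrite c'j ij.
  + case=> li _; case: (stepP wfc jN cc') => [jl|jl _ jle|jE ej e'E cl].
    * by lia.
    * have {}jl : c.1.1 = j by lia.
      rewrite jl /= inord_val ldiv_near2; last by rewrite /near inordK; lia.
      move=> uw; apply: divides_res_next; rewrite c'j; first lia.
      by rewrite /= inord_val.
    * rewrite -jE /= inord_val ldiv_cons => uw.
      by exists (ascent c.1.1 c.1.1) => //; rewrite ascent1.
  + rewrite ascent_cons // => -[li _].
    case: (stepP wfc jN cc') => [jl|jl _ jle|jE ej e'E cl]; [lia|lia|].
    rewrite -ascent_cons // -jE ldiv_ascent_start; last lia.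
    have -> : c.1.2 = c'.1.2 by rewrite e'E; lia.
    move=> uw; exists (ascent j.+1 c'.1.2) => //.
    rewrite -c'j; apply: residual_ascent; rewrite c'j e'E.
    by rewrite leq_max; lia.
  + by case=> ki _; case: (stepP wfc jN cc') => [jl|jl _ jle|jE]; lia.
- exact: divides_res_larger kw.
- have rightP (k : 'I_N.+1) : k = j.+1 :> nat -> ldiv (letters N [:: j.+1;
    (j : nat)]) w ->
      exists2 k : 'I_N.+1, j < k & ldiv [:: k] (j :: w).
    move=> kj; rewrite /= inord_val -kj inord_val => kw; exists k;
      first by rewrite kj.
    by rewrite ldiv_near1 // /near kj; lia.
  case: cu uw => [i il|lN el|lte|k lk].
  + rewrite c'j in il *; have [il'|[iE jE ->]] := step_stack_inv cc' il.
      have ij : i < j by case/andP: il.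
      have [_ ->] := step_stack cc' ij il';
        rewrite -ldiv_ascent_prolong ?sN // => uw.
      by left; exists (ascent i (nth 0 c.2 (c.1.1.-1 - i))) => //;
        apply: residual_stack.
    rewrite ascent1 => uw; left; exists [:: c.1.1.+1; c.1.1].
      apply: residual_desc; first lia.
      by case: (stepP wfc jN cc') => [jl|jl|_]; rewrite -?jE //; lia.
    by rewrite -jE -iE /= inord_val ldiv_cons.
  + rewrite c'j in lN *; move=> uw; right; apply: (rightP (inord j.+1)) => //.
    by rewrite inordK.
  + rewrite c'j in lte *;
      case: (stepP wfc jN cc') => [jl je' e'E|jl e'E|jE ej e'E cl].
    * rewrite -ldiv_ascent_start; last lia.
      move=> uw; left; exists (ascent j c'.1.2) => //; rewrite e'E.
      exact: residual_stack.
    * by lia.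
    * rewrite -ldiv_ascent_start; last lia.
      have -> : c'.1.2 = c.1.2 by lia.
      move=> uw; left; exists (ascent j c.1.2) => //; rewrite jE.
      by apply: residual_ascent; lia.
  + rewrite c'j in lk *; move=> uw; right; exists (inord k);
      first by rewrite inordK; lia.
    by rewrite ldiv_all_far1 // /far inordK; lia.
Qed.

(** A residual that divides a single letter is that letter, and [step] refuses exactly the residuals
    of length one. *)
Lemma step_NoneP c (j : 'I_N.+1) : wf_config c ->
  (step c j == None) <-> divides_res c [:: j].
Proof.
move=> wfc; have jN : j <= N := ltn_ord j; have [/andP [le eN] sl sN] := wfc.
split=> [/eqP|[u cu uj]].
  have resj : residual c [:: (j : nat)] -> divides_res c [:: j].
    move=> cj; exists [:: (j : nat)] => //=; rewrite inord_val; exact: ldiv_refl.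
  case: c wfc le eN sl sN resj => [[l e] s] /= wfc le eN sl sN resj; rewrite /step.
  case: ifP => [lj _|_].
    by apply/resj/residual_top; rewrite /= lj.
  case: eqP => [jE|jl].
    case: eqP => // ej _; apply: resj; rewrite -ascent1.
    have := @residual_ascent (l, e, s); rewrite /= ej -jE; apply; lia.
  case: ifP => // /andP[/andP[jl' ls] /eqP fj] _; apply: resj; rewrite -ascent1.
  have := @residual_stack (l, e, s) j; rewrite /=.
  have -> : nth 0 s (l.-1 - j) = j; last by apply; lia.
  rewrite -[RHS]fj (_ : l - j = (l.-1 - j).+1) /=; last lia.
  by apply: set_nth_default; lia.
have [i [v [ui iN]]] := residual_head wfc cu.
have iE : i = j.
  have /ldiv_mem/(_ (inord i)) := uj; rewrite ui /= mem_head inE => /(_ isT)/eqP <-.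
  by rewrite inordK.
have {v ui iN} ui : u = [:: (j : nat)].
  have := ldiv_size uj; rewrite ui /= size_map iE.
  by case: v {ui}.
apply/eqP; case cc': (step c j) => [c'|//]; exfalso.
case: cu ui => [i' il|//|lte|k lk].
- have sj := sN _ il; rewrite ascent_cons; last by case/andP: sj.
  case=> i'j; rewrite i'j in il sj *.
  rewrite /ascent => /(congr1 size); rewrite size_iota /= => sz.
  by case: (stepP wfc jN cc') => [jl je' e'E|jl _ jle|jE]; lia.
- rewrite ascent_cons // => -[lj].
  rewrite /ascent => /(congr1 size); rewrite size_iota /= => sz.
  by case: (stepP wfc jN cc') => [jl je' e'E|jl _ jle|jE]; lia.
- by case=> kj; case: (stepP wfc jN cc') => [jl je' e'E|jl _ jle|jE]; lia.
Qed.

End Configurations.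

(** * From words to configurations, and from configurations to states *)

Section Tracking.
Variable N : nat.
Implicit Types (c : config) (i j k : nat) (u v : seq nat) (x y : word N.+1).

Inductive reads : word N.+1 -> config -> Prop :=
| reads_nil : reads [::] (start_config N)
| reads_rcons x c (j : 'I_N.+1) c' :
    reads x c -> step c j = Some c' -> reads (rcons x j) c'.

Lemma reads_spec x c : reads x c ->
  [/\ wf_config N c, lexmax x & forall y, ~ admits x y <-> divides_res c y].
Proof.
elim=> {x c} [|x c j c' _ [wfc gx xc] cc'].
  split=> //= [|y]; first exact: wf_start.
  split=> // -[u [i /=|/=|/=|k /=]]; by [lia|rewrite ltnn].
have jN : j <= N := ltn_ord j.
split; first exact: wf_step cc'.
- apply/lexmax_rcons; split=> //; apply: contrapT => /xc/(step_NoneP _ wfc).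
  by rewrite cc'.
- move=> y; rewrite admits_rcons -(divides_res_step _ wfc cc') -xc.
  split=> [nxy|[xy [? _]//|[k jk ky] [_ /(_ _ ky)]]]; last by rewrite leqNgt jk.
  have [xy|] := pselect (admits x (j :: y)); last by left.
  right; apply: contrapT => nk; apply: nxy; split=> // k ky.
  by rewrite leqNgt; apply/negP => jk; apply: nk; exists k.
Qed.

Lemma lexmax_reads x : lexmax x -> exists c, reads x c.
Proof.
elim/last_ind: x => [_|x j IH /lexmax_rcons [gx xj]].
  by exists (start_config N); exact: reads_nil.
have [c rc] := IH gx; have [wfc _ xc] := reads_spec rc.
case cc': (step c j) => [c'|]; first by exists c'; exact: reads_rcons cc'.
by case: ((xc [:: j]).2 _ xj); apply/step_NoneP => //; rewrite cc'.
Qed.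

Variant simple_res : seq nat -> Prop :=
| simple_ascent i k of i <= k <= N : simple_res (ascent i k)
| simple_desc i of i < N : simple_res [:: i.+1; i].

Lemma residual_simple c u : wf_config N c -> residual N c u -> simple_res u.
Proof.
move=> [/andP [le eN] _ sN] [i il|lN _|lte|k lk].
- by apply: simple_ascent; exact: sN.
- exact: simple_desc.
- by apply: simple_ascent; lia.
- by rewrite -ascent1; apply: simple_ascent; lia.
Qed.

Lemma simple_first u (j : 'I_N.+1) : simple_res u ->
  ldiv [:: j] (letters N u) -> j = head 0 u :> nat.
Proof.
case=> [i k ik|i iN]; last exact: ldiv_desc_first.
by move/ldiv_ascent_first => -> //; rewrite ascent_cons //; case/andP: ik.
Qed.

Lemma simple_size u : simple_res u -> 0 < size u.
Proof. by case=> // i k ik; rewrite size_iota; lia. Qed.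

Lemma simple_bound u : simple_res u -> {in u, forall i, i <= N}.
Proof.
case=> [i k ik x|i iN x]; first by rewrite mem_ascent; lia.
by rewrite !inE => /orP [] /eqP ->; lia.
Qed.

Lemma simple_head_ldiv u v : simple_res u -> simple_res v ->
  ldiv (letters N u) (letters N v) -> head 0 u = head 0 v.
Proof.
move=> su sv uv; have := simple_size su; have := simple_bound su.
case: u su uv => //= i u su uv /(_ _ (mem_head _ _)) iN _.
by rewrite -(@simple_first v (inord i)) ?inordK //; apply: (@ldiv_catl _ [:: _]) uv.
Qed.

Lemma simple_mem_ldiv u v : simple_res u -> simple_res v ->
  ldiv (letters N u) (letters N v) -> {subset u <= v}.
Proof.
move=> su sv /ldiv_mem uv k ku.
have /mapP [m mv] := uv _ (map_f (@inord N) ku).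
move/(congr1 val); rewrite /= !inordK ?ltnS => [->//||].
  exact: simple_bound sv _ mv.
exact: simple_bound su _ ku.
Qed.

Lemma size_ascent i k : size (ascent i k) = k.+1 - i.
Proof. exact: size_iota. Qed.

Lemma head_ascent i k : i <= k -> head 0 (ascent i k) = i.
Proof. by move=> ik; rewrite ascent_cons. Qed.

Lemma ascent_inj i k k' : i <= k -> i <= k' -> ascent i k = ascent i k' -> k = k'.
Proof. by move=> ik ik' /(congr1 size); rewrite !size_iota; lia. Qed.

(** Length, letters and the unique first divisor tell these words apart, so equal states have equal
    sets of residual words. *)
Lemma simple_braid_eq u v : simple_res u -> simple_res v ->
  letters N u ~~ letters N v -> u = v.
Proof.
move=> su sv uv.
have sz : size u = size v by have := braid_eq_size uv; rewrite !size_map.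
have uv1 : ldiv (letters N u) (letters N v) by exists [::]; rewrite cats0 uv.
have vu1 : ldiv (letters N v) (letters N u) by exists [::]; rewrite cats0 uv.
have := simple_mem_ldiv su sv uv1; have := simple_mem_ldiv sv su vu1.
have := simple_head_ldiv su sv uv1.
case: su sv sz {uv uv1 vu1} => [i k ik|i iN] [i' k' ik'|i' iN'].
- rewrite !head_ascent ?size_ascent; [|lia|lia].
  by move=> sz ii' _ _; rewrite ii'; congr ascent; lia.
- rewrite head_ascent; last lia.
  by move=> _ /= -> /(_ i'); rewrite mem_ascent !inE eqxx orbT; lia.
- rewrite head_ascent; last lia.
  by move=> _ /= <- _ /(_ i); rewrite mem_ascent !inE eqxx orbT; lia.
- by move=> _ /= [->].
Qed.

(** Inversion of [residual] by the first letter; only [l + 1] can start two residuals. *)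
Variant residual_at c i u : Prop :=
| at_stack of i < c.1.1 <= i + size c.2
    & u = ascent i (nth 0 c.2 (c.1.1.-1 - i))
| at_desc of i = c.1.1.+1 & c.1.1 < N & c.1.2 != c.1.1.+1
    & u = [:: c.1.1.+1; c.1.1]
| at_ascent of i = c.1.1.+1 & c.1.1 < c.1.2 & u = ascent c.1.1.+1 c.1.2
| at_top of c.1.1.+1 < i <= N & u = [:: i].

Lemma residual_headP c u : wf_config N c -> residual N c u ->
  residual_at c (head 0 u) u.
Proof.
move=> [/andP [le eN] _ sN] [i il|lN ne|lte|k lk].
- by rewrite head_ascent; [apply: at_stack|case/andP: (sN _ il)].
- exact: at_desc.
- by rewrite head_ascent //; apply: at_ascent.
- exact: at_top.
Qed.

(** Divisibility forces equal first letters. The only two distinct residuals that share one are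
    [[:: l.+1; l]] and the ascent from [l + 1] to [e >= l + 2], and each of them contains a letter
    that the other lacks. *)
Lemma residual_antichain c u v : wf_config N c -> residual N c u ->
  residual N c v ->
  ldiv (letters N u) (letters N v) -> u = v.
Proof.
move=> wfc cu cv uv.
have [su sv] := (residual_simple wfc cu, residual_simple wfc cv).
have sub := simple_mem_ldiv su sv uv; have := residual_headP wfc cu.
rewrite (simple_head_ldiv su sv uv).
case: (residual_headP wfc cv) =>
  [lt vE|E lt ne vE|E lt vE|lt vE] [lt' uE|E' lt' ne' uE|E' lt' uE|lt' uE];
  try lia.
- by rewrite uE -vE.
- by rewrite uE -vE.
- by have := sub c.1.1.+2; rewrite uE vE mem_ascent !inE; lia.
- by have := sub c.1.1; rewrite uE vE mem_ascent !inE eqxx orbT; lia.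
- by rewrite uE -vE.
- by rewrite uE -vE.
Qed.

Definition res_set c : set (braid N.+1) :=
  [set eval (letters N u) | u in residual N c]%classic.

Lemma forbidden_reads x c : reads x c -> forbidden_prefixes (eval x) = res_set c.
Proof.
move=> /reads_spec [wfc gx xc]; apply/seteqP; split=> b; rewrite -(eval_repr b).
  move=> /(forbidden_prefixesP _ gx) [/xc [u cu ub] bmin].
  exists u => //; apply/eval_eq; apply: bmin ub.
  by apply/xc; exists u => //; exact: ldiv_refl.
move=> [u cu]; rewrite eval_repr => <-; apply/forbidden_prefixesP => //; split.
  by apply/xc; exists u => //; exact: ldiv_refl.
move=> z /xc [v cv vz] zu.
(* By the antichain property [v] is [u], so [z] lies between [u] and [u], and lengths leave no room
   for a further factor. *)
have vu := ldiv_trans vz zu; have vE := residual_antichain wfc cv cu vu.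
case: vz zu => s zs [t ut]; rewrite vE in zs.
have := braid_eq_size ut; rewrite size_cat (braid_eq_size zs) size_cat => sz.
have s0 : s = [::] by apply: size0nil; lia.
by rewrite zs s0 cats0.
Qed.

Lemma res_set_sub c c' u : wf_config N c -> wf_config N c' ->
  res_set c = res_set c' ->
  residual N c u -> residual N c' u.
Proof.
move=> wfc wfc' cc' cu.
have : res_set c (eval (letters N u)) by exists u.
rewrite cc' => -[v cv /eval_eq vu].
by rewrite -(simple_braid_eq (residual_simple wfc' cv) (residual_simple wfc cu) vu).
Qed.

Lemma residual_above c k : wf_config N c -> c.1.1 < k <= N ->
  exists2 u, residual N c u & head 0 u = k.
Proof.
move=> [/andP [le eN] _ _] lk; have [kE|kl] := eqVneq k c.1.1.+1; last first.
  by exists [:: k] => //; apply: residual_top; lia.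
have [eE|ne] := eqVneq c.1.2 c.1.1.+1; last first.
  by exists [:: c.1.1.+1; c.1.1]; [apply: residual_desc; lia|rewrite kE].
exists (ascent c.1.1.+1 c.1.2); first by apply: residual_ascent; lia.
by rewrite eE ascent1 kE.
Qed.

(** * Recovering a configuration from its residuals *)

Section Injectivity.
Variables c c' : config.
Hypotheses (wfc : wf_config N c) (wfc' : wf_config N c').
Hypothesis sub : forall u, residual N c u -> residual N c' u.

(** The last letter is the greatest letter that starts no residual: [residual_above] gives one for
    each letter above it. *)
Lemma residual_sub_last : c'.1.1 <= c.1.1.
Proof.
rewrite leqNgt; apply/negP => lt; have [/andP [le eN] _ _] := wfc'.
have [|u /sub/(residual_headP wfc') + uE] := @residual_above c c'.1.1 wfc;
  first lia.
by rewrite uE; case; lia.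
Qed.

Lemma residual_sub_stack i : c.1.1 = c'.1.1 -> i < c.1.1 <= i + size c.2 ->
  c'.1.1 <= i + size c'.2 /\
  nth 0 c.2 (c.1.1.-1 - i) = nth 0 c'.2 (c'.1.1.-1 - i).
Proof.
move=> ll' il; have [_ _ /(_ _ il) sN] := wfc; have [_ _ sN'] := wfc'.
have := residual_headP wfc' (sub (residual_stack N il)).
rewrite head_ascent; last by case/andP: sN.
case=> [il' E|||]; try lia.
by have := sN' _ il' => bd; split; [|apply: ascent_inj E]; lia.
Qed.

Lemma residual_sub_end : c.1.1 = c'.1.1 -> c.1.1 < c.1.2 -> c.1.2 = c'.1.2.
Proof.
move=> ll' lte; have := residual_headP wfc' (sub (residual_ascent N lte)).
rewrite head_ascent //; case=> [|E lt ne|_ lt' E|]; [lia| | |lia].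
  rewrite ascent_cons // ll' => -[E'];
    have : c'.1.1 \in ascent c'.1.1.+2 c.1.2 by rewrite E' inE.
  by rewrite mem_ascent; lia.
by move: E; rewrite ll' => /ascent_inj; apply; lia.
Qed.

End Injectivity.

Lemma res_set_inj c c' : wf_config N c -> wf_config N c' ->
  res_set c = res_set c' -> c = c'.
Proof.
move=> wfc wfc' cc'.
have sub := res_set_sub wfc wfc' cc'; have sub' := res_set_sub wfc' wfc (esym cc').
have ll' : c.1.1 = c'.1.1.
  by apply/eqP; rewrite eqn_leq !residual_sub_last.
have [_ sl _] := wfc; have [_ sl' _] := wfc'.
have ss' : size c.2 = size c'.2.
  apply/eqP; rewrite eqn_leq; apply/andP; split; rewrite leqNgt; apply/negP => lt.
    have [|] := residual_sub_stack wfc wfc' sub ll' (i := c.1.1 - size c.2); lia.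
  have [|] := residual_sub_stack wfc' wfc sub' (esym ll') (i := c'.1.1 - size c'.2); lia.
have ee' : c.1.2 = c'.1.2.
  have [/andP [le _] _ _] := wfc; have [/andP [le' _] _ _] := wfc'.
  have [lte|lte] := ltnP c.1.1 c.1.2; first exact: residual_sub_end.
  have [lte'|lte'] := ltnP c'.1.1 c'.1.2; last lia.
  by apply/esym/residual_sub_end.
case: c c' wfc wfc' sub ll' ss' ee' sl {cc' sub' sl'} => [[l e] s] [[l' e'] s'] /=.
move=> wfc wfc' sub ll' ss' ee' sl; congr (_, _, _) => //.
apply: (@eq_from_nth _ 0) => // k ks.
have [|] := residual_sub_stack wfc wfc' sub ll' (i := l.-1 - k);
  first by rewrite /=; lia.
by rewrite /= -ll' (_ : l.-1 - (l.-1 - k) = k) //; lia.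
Qed.

Lemma states_GammaE :
  states (Gamma N.+1) = [set res_set c | c in [set c | exists x,
    reads x c]]%classic.
Proof.
apply/seteqP; split=> [_ [b _ <-]|_ [c [x rc] <-]].
  have [c rc] := lexmax_reads (lexmax_max_rep b).
  exists c; first by exists (max_rep b).
  by rewrite -(forbidden_reads rc) eval_max_rep.
by exists (eval x) => //; exact: forbidden_reads.
Qed.

End Tracking.

(** * Reachable stacks *)

Local Notation D := (@None bool).
Local Notation X := (Some false).
Local Notation V := (Some true).

Definition height (w : seq (option bool)) := count isSome w.
Definition drops (w : seq (option bool)) := count (pred1 D) w.
Arguments height : simpl never.
Arguments drops : simpl never.

Section Profiles.
Variable N : nat.
Implicit Types (w u : seq (option bool)) (t m g b d j l k : nat).


Lemma height_cons a w : height (a :: w) = isSome a + height w. Proof. by []. Qed.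
Lemma drops_cons a w : drops (a :: w) = (a == D) + drops w. Proof. by []. Qed.

Lemma size_height_drops w : size w = height w + drops w.
Proof.
by elim: w => // a w IH; rewrite height_cons drops_cons /= IH;
  case: a => [a|] /=; lia.
Qed.

Lemma drops_hgt w : drops w = size w - height w.
Proof. by rewrite size_height_drops addKn. Qed.

(* The stack coded by [w], read from its top, whose bottom entry belongs to the
   initial letter [t]; the level pushed by [V] is [N] minus the number of [D]
   below it. *)
Fixpoint stack t w : seq nat :=
  if w is a :: u then
    match a with
    | None => stack t u
    | Some false => t + height u :: stack t u
    | _ => N - drops u :: stack t u
    end
  else [::].

Definition xhead w := if w is Some false :: _ then true else false.

(** Since [D X] and [X D] code the same stack, these are the normal forms for moving each [X]
    towards the top; [norm] computes them. *)
Fixpoint reduced w := if w is a :: u then (isSome a || ~~ xhead u) && reduced u else true.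

Definition same_stack w u := [/\ size w = size u, height w =
  height u & forall t, stack t w = stack t u].

Lemma same_stack_sym w u : same_stack w u -> same_stack u w.
Proof. by move=> [? ? H]; split. Qed.

Lemma same_stack_trans w u v : same_stack w u -> same_stack u v -> same_stack w v.
Proof. move=> [sz hg st] [sz' hg' st'].
by split=> [||t]; rewrite ?sz ?hg ?st. Qed.

Lemma same_stack_cons a w u : same_stack w u -> same_stack (a :: w) (a :: u).
Proof.
move=> [sz hg st]; split=> [||t]; first by rewrite /= sz.
  by rewrite !height_cons hg.
rewrite /= st; case: a => [[]|] //; last by rewrite hg.
by rewrite !drops_hgt sz hg.
Qed.

Lemma same_stack_cat v w u : same_stack w u -> same_stack (v ++ w) (v ++ u).
Proof. by elim: v => //= a v IH /IH; exact: same_stack_cons. Qed.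

Lemma same_stack_DX w : same_stack (D :: X :: w) (X :: D :: w).
Proof. by []. Qed.

Lemma same_stack_DnX m w : same_stack (nseq m D ++ X :: w) (X :: nseq m D ++ w).
Proof.
elim: m => [|m IH] //=.
exact: same_stack_trans (same_stack_cons _ IH) (same_stack_DX _).
Qed.

Fixpoint sink w := if w is Some false :: u then X :: sink u else D :: w.

Fixpoint norm w :=
  if w is a :: u then if a is None then sink (norm u) else a :: norm u else [::].

Lemma sinkP w : reduced w -> reduced (sink w) /\ same_stack (sink w) (D :: w).
Proof.
elim: w => [|a w IH] //= /andP [aw wn].
case: a aw => [[]|] //= aw; try by rewrite ?aw ?wn.
have [nw ww] := IH wn; rewrite nw; split=> //.
by apply: same_stack_trans (same_stack_cons _ ww) (same_stack_sym (same_stack_DX _)).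
Qed.

Lemma normP w : reduced (norm w) /\ same_stack (norm w) w.
Proof.
elim: w => [|a w [nw ww]] //=; case: a => [a|].
  by split=> //=; exact: same_stack_cons.
have [ns ws] := sinkP nw; split=> //; apply: same_stack_trans ws _;
  exact: same_stack_cons.
Qed.

(* [d] is the difference [e - l]. *)
Definition config_of w d : config :=
  let l := N - size w + height w in (l, l + d, stack (N - size w) w).

Lemma config_of_same_stack w u d : same_stack w u -> config_of w d = config_of u d.
Proof. by move=> [sz hg st]; rewrite /config_of sz hg st. Qed.

(* When [e = l + b + 1], the end [l] can only occur once in the stack, with
   [g - 1] ascents of length one above it and ends at least [e] below it. *)
Definition gapped w g b :=
  (if g is h.+1 then nseq h X ++ [:: V] else [::]) ++ nseq b.+1 D ++ w.

Lemma height_cat w u : height (w ++ u) = height w + height u.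
Proof. exact: count_cat. Qed.

Lemma drops_cat w u : drops (w ++ u) = drops w + drops u.
Proof. exact: count_cat. Qed.

Lemma height_nseq m a : height (nseq m a) = isSome a * m.
Proof. exact: count_nseq. Qed.

Lemma drops_nseq m a : drops (nseq m a) = (a == D) * m.
Proof. exact: count_nseq. Qed.

Lemma size_gapped w g b : size (gapped w g b) = size w + g + b.+1.
Proof.
rewrite /gapped; case: g => [|h]; rewrite !size_cat ?size_cat !size_nseq /=; lia.
Qed.

Lemma height_gapped w g b : height (gapped w g b) = height w + g.
Proof.
by rewrite /gapped; case: g => [|h];
  rewrite !height_cat ?height_cat !height_nseq /height /=; lia.
Qed.

Lemma gapped_same_stack w u g b : same_stack w u ->
  same_stack (gapped w g b) (gapped u g b).
Proof. by move=> wu; do 2! apply: same_stack_cat. Qed.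

Lemma size_stack t w : size (stack t w) = height w.
Proof. by elim: w => //= [[[]|]] w //= ->. Qed.

Lemma stack_nseqD t m w : stack t (nseq m D ++ w) = stack t w.
Proof. by elim: m. Qed.

(** The first bound holds for entries pushed by [X], the second for those pushed by [V]. Hence a
    letter [j] with [t + height w < j <= N - drops w] prolongs no entry. *)
Lemma stack_mem t w x : x \in stack t w -> x < t + height w \/ N - drops w <= x.
Proof.
elim: w => //= -[[]|] w IH; rewrite height_cons drops_cons ?inE /=.
- by case/predU1P => [->|/IH]; lia.
- by case/predU1P => [->|/IH]; lia.
- by move/IH; lia.
Qed.

(** Without an [X] on top, the letter [t + height w] does not prolong anything either, if
    [t + size w <= N]. *)
Lemma stack_mem_reduced t w x : reduced w -> ~~ xhead w -> x \in stack t w ->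
  x.+1 < t + height w \/ N - drops w <= x.
Proof.
elim: w => //= -[[]|] w IH //=; rewrite height_cons drops_cons ?inE /=.
- by move=> _ _ /predU1P [->|/stack_mem]; lia.
- by move=> /andP [xw nw] _ /(IH nw xw); lia.
Qed.

Lemma map_prolong_id j s : {in s, forall x, x.+1 != j} -> map (prolong j) s = s.
Proof.
by move=> sj; apply: map_id_in => x /sj /negbTE xj; rewrite /prolong xj.
Qed.

Lemma prolong_stack_reduced t w : reduced w -> ~~ xhead w -> t + size w <= N ->
  map (prolong (t + height w)) (stack t w) = stack t w.
Proof.
move=> nw xw tw; apply: map_prolong_id => x /(stack_mem_reduced nw xw).
by have := size_height_drops w; lia.
Qed.

Lemma prolong_stack_X t w : t + size w < N ->
  map (prolong (t + height (X :: w))) (stack t (X :: w)) =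
    t + height (X :: w) :: stack t w.
Proof.
move=> tw; rewrite height_cons /= {1}/prolong (_ : (t + height w).+1 == _);
  last lia.
congr (_ :: _).
apply: map_prolong_id => x /stack_mem; have := size_height_drops w; lia.
Qed.

Definition profiled (c : config) : Prop :=
  (exists w, [/\ reduced w, size w <= N & c = config_of w 0]) \/
  (exists w g b, [/\ reduced w, size w + g + b < N & c =
    config_of (gapped w g b) b.+1]).

(* A stack is left behind by a letter [t + height w] that may prolong its top run;
   [d] records how far beyond that letter the next run still reaches. *)
Lemma profiled_land t w d : t + size w + d = N ->
  profiled (t + height w, t + height w + d,
    map (prolong (t + height w)) (stack t w)).
Proof.
move=> tN; have [nw [sz hg st]] := normP w; rewrite -sz in tN; rewrite -hg -st.
move: (norm w) nw tN => {hg st sz} {}w nw tN.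
have [|xw] := boolP (xhead w); last first.
  rewrite prolong_stack_reduced //; last lia.
  case: d tN => [|b] tN; [left; exists w|right; exists w, 0, b]; split=> //;
    try lia.
    by rewrite /config_of (_ : N - size w = t) //; lia.
  by rewrite /config_of size_gapped height_gapped !addn0 stack_nseqD (_ : N - _ = t) //; lia.
(* The ascent of length one on top is prolonged up to the letter just read, so its [X] becomes a
   [V]: directly for [d = 0], above [b + 1] letters [D] otherwise. *)
case: w nw tN => [|[[]|] w] // nw; rewrite [size _]/= => tN _.
rewrite prolong_stack_X; last lia.
case: d tN => [|b] tN; [left; exists (V :: w)|right; exists w, 1, b];
  split=> //; try (rewrite /=; lia).
  rewrite /config_of /= !height_cons (_ : N - (size w).+1 = t) /=; last lia.
  by rewrite (_ : N - drops w = t + (1 + height w)) //;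
    have := size_height_drops w; lia.
rewrite /config_of size_gapped height_gapped /gapped /= stack_nseqD (_ : N - (_ + _) = t); last lia.
rewrite height_cons [1 + _]addnC (_ : N - _ = t + (height w + 1)) //.
by rewrite drops_cons drops_cat drops_nseq /=; have := size_height_drops w; lia.
Qed.

Lemma stack_split t w1 w2 a : nth 0 (stack t (w2 ++ Some a :: w1)) (height w2) =
    (if a then N - drops w1 else t + height w1) /\
  drop (height w2).+1 (stack t (w2 ++ Some a :: w1)) = stack t w1.
Proof.
elim: w2 => [|c w2 [IH1 IH2]]; first by case: a; rewrite /= drop0.
by case: c => [[]|]; rewrite height_cons.
Qed.

Lemma height_split w k : k < height w ->
  exists w1 w2 a, w = w2 ++ Some a :: w1 /\ height w1 = k.
Proof.
elim: w => // -[a|] w IH; rewrite height_cons /=.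
  rewrite ltnS leq_eqVlt => /predU1P [->|/IH [w1 [w2 [a' [-> <-]]]]].
    by exists w, [::], a.
  by exists w1, (Some a :: w2), a'.
by move=> /IH [w1 [w2 [a' [-> <-]]]]; exists w1, (D :: w2), a'.
Qed.

Lemma drops_split w : 0 < drops w ->
  exists w1 w2, w = w2 ++ D :: w1 /\ drops w2 = 0.
Proof.
elim: w => // -[a|] w IH; rewrite drops_cons /=; last by exists w, [::].
by move=> /IH [w1 [w2 [-> w2D]]]; exists w1, (Some a :: w2).
Qed.

(** Every [V] above the first [D] pushes [l]. Reading [l + 1] prolongs these ascents, which amounts
    to deleting that [D]. *)
Lemma prolong_push t w1 w2 l : drops w2 = 0 -> t + height (w2 ++ D :: w1) <= l ->
  drops (D :: w1) + l = N ->
  map (prolong l.+1) (stack t (w2 ++ D :: w1)) = stack t (w2 ++ w1).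
Proof.
move=> + + lE; rewrite drops_cons /= in lE; elim: w2 => [|a w2 IH] w2D tl.
  rewrite /=; apply: map_prolong_id => x /stack_mem;
    rewrite height_cons /= in tl; lia.
have w2D' : drops w2 = 0 by move: w2D; rewrite drops_cons; lia.
have hE : height (w2 ++ D :: w1) = height (w2 ++ w1) by rewrite !height_cat.
case: a w2D tl => [[]|] // w2D; rewrite /= height_cons /= => tl.
- rewrite IH //; last lia.
  congr (_ :: _); rewrite /prolong !drops_cat drops_cons w2D' /=.
  by case: eqP => //; lia.
- rewrite IH ?hE //; last lia.
  by congr (_ :: _); rewrite /prolong; case: eqP => //; lia.
Qed.

Lemma step_config_of_push w1 w2 d : drops w2 = 0 ->
  size (w2 ++ D :: w1) <= N -> d != 1 ->
  step (config_of (w2 ++ D :: w1) d) (config_of (w2 ++ D :: w1) d).1.1.+1 =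
    Some (config_of (X :: w2 ++ w1) d.-1).
Proof.
set w := w2 ++ _ => w2D wN d1; have := size_height_drops w.
have lw : drops w = (drops w1).+1 by rewrite drops_cat drops_cons w2D.
have hw : height (w2 ++ w1) = height w by rewrite !height_cat.
have sw : size (X :: w2 ++ w1) = size w by rewrite /= !size_cat addnS.
move=> sw'; rewrite /config_of [X in step X]/= [in X in step _ X]/= /step ltnn eqxx.
rewrite sw height_cons hw /=; case: eqP => [|_]; first lia.
congr (Some (_, _, _)); [lia|lia|congr (_ :: _)].
  by rewrite hw.
by rewrite prolong_push // ?drops_cons /=; lia.
Qed.

Lemma step_config_of_last w d : step (config_of w d) (config_of w d).1.1 =
  Some ((config_of w d).1.1, (config_of w d).1.1,
    map (prolong (config_of w d).1.1) (stack (N - size w) w)).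
Proof. by rewrite /step /= ltnNge leqnSn /= ltn_eqF // ltnn subnn drop0. Qed.

Lemma step_config_of_pop w1 w2 d : size (w2 ++ V :: w1) <= N ->
  let t := N - size (w2 ++ V :: w1) in
  step (config_of (w2 ++ V :: w1) d) (t + height w1) =
    Some (t + height w1, N - drops w1, map (prolong (t + height w1)) (stack t w1)).
Proof.
set w := w2 ++ _ => wN t; rewrite /step /= -/t.
have hw : height w = height w2 + (height w1).+1 by rewrite height_cat.
have [nE dE] := stack_split t w1 w2 true.
have -> : t + height w - (t + height w1) = (height w2).+1 by lia.
have sw := size_height_drops w1;
  have ww : size w = size w2 + (size w1).+1 by rewrite size_cat.
rewrite dE ltnNge (_ : t + height w1 <= _) /=; last lia.
rewrite (set_nth_default 0) ?size_stack ?nE; last lia.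
rewrite ltn_eqF; last lia.
by case: ifP => // /andP [_ /eqP]; lia.
Qed.

Lemma profiled_step c c' j : profiled c -> j <= N -> step c j = Some c' ->
  profiled c'.
Proof.
move=> fc jN cc'.
have [w [d [cE wN]]] : exists w d, c = config_of w d /\ size w <= N.
  case: fc => [[w [_ wN ->]]|[w [g [b [_ wN ->]]]]]; first by exists w, 0.
  by exists (gapped w g b), b.+1; rewrite size_gapped; split=> //; lia.
have sw := size_height_drops w; set t := N - size w.
have [jl|lj] := leqP j (t + height w); last first.
  (* The letter is [l + 1]: the first [D] of the code is deleted and an [X] is put on top. *)
  have jE : j = (config_of w d).1.1.+1.
    move: cc'; rewrite cE /step; case: ifP => // /negbT; rewrite -leqNgt => jl _.
    by rewrite /= -/t in jl *; lia.
  case: fc => [[u [nu uN cE']]|[u [g [b [nu uN cE']]]]]; move: cc';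
    rewrite jE -cE cE'.
    have [w1 [w2 [uE w2D]]] : exists w1 w2, u = w2 ++ D :: w1 /\ drops w2 = 0.
      apply: drops_split; have := size_height_drops u.
      by have := congr1 (fun c : config => c.1.1) cE'; rewrite cE /= -/t; lia.
    rewrite uE in uN *; rewrite step_config_of_push // => -[<-].
    left; exists (norm (X :: w2 ++ w1)); have [nn nw] := normP (X :: w2 ++ w1).
    split=> //; last exact/esym/config_of_same_stack.
    by case: nw => -> _ _; move: uN; rewrite /= !size_cat /= addnS.
  case: b uN cE' => [|b] uN cE'.
    by rewrite /step /= ltnn eqxx /= addn1 eqxx.
  (* For [g = 0] the new [X] sinks below the letters [D] into [u]; for [g > 0] it joins the run of
     [X] above the [V]. In both cases the gap shrinks by one. *)
  case: g uN cE' => [|h] uN cE'.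
    rewrite (_ : gapped u 0 b.+1 = [::] ++ D :: nseq b.+1 D ++ u) //.
    rewrite step_config_of_push //; last by rewrite /= size_cat size_nseq; lia.
    move=> [<-]; right; exists (norm (X :: u)), 0, b.
    have [nn nw] := normP (X :: u); split=> //; first by case: nw => -> _ _ /=; lia.
    apply: config_of_same_stack; apply: same_stack_sym;
      apply: same_stack_trans (gapped_same_stack _ _ nw) _.
    exact: same_stack_DnX.
  rewrite (_ : gapped u h.+1 b.+1 =
    (nseq h X ++ [:: V]) ++ D :: nseq b.+1 D ++ u) //.
  rewrite step_config_of_push //; last first.
  - by rewrite !size_cat /= !size_cat !size_nseq; lia.
  - by rewrite drops_cat drops_nseq.
  by move=> [<-]; right; exists u, h.+2, b; split=> //; lia.
have {fc} : True by []; move=> _.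
(* Below the bottom of the stack every entry is dropped, and only the level [j] remains to be
   coded. *)
have [jt|tj] := ltnP j t.
  left; exists (nseq (N - j) D); split.
  - by elim: (N - j) => //= -[].
  - by rewrite size_nseq leq_subr.
  have := cc'; rewrite cE /step /= ltnNge (leq_trans jl) //= -/t.
  rewrite ltn_eqF // size_stack (leqNgt _ (height w)) (_ : height w < _) ?andbF /=; last lia.
  move=> [<-]; rewrite /config_of size_nseq height_nseq mul0n addn0 subKn // addn0.
  rewrite drop_oversize ?size_stack ?nth_default //=; try lia.
  - by have := stack_nseqD j (N - j) [::]; rewrite cats0 => ->.
  - by rewrite size_stack; lia.
have [jlE|jl'] := eqVneq j (t + height w).
  have := cc'; rewrite cE jlE step_config_of_last => -[<-] /=.
  by rewrite -/t -[X in (_, X, _)]addn0; apply: profiled_land; lia.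
have [w1 [w2 [a [wE w1j]]]] : exists w1 w2 a, w =
  w2 ++ Some a :: w1 /\ height w1 = j - t.
  by apply: height_split; lia.
have jE : j = t + height w1 by lia.
have sw1 := size_height_drops w1;
  have ww : size w = size w2 + (size w1).+1 by rewrite wE size_cat.
case: a wE => wE.
  have := cc'; rewrite cE jE /t wE step_config_of_pop; last by rewrite -wE.
  move=> [<-]; rewrite -wE -/t.
  rewrite (_ : N - drops w1 =
    t + height w1 + (N - drops w1 - (t + height w1))); last lia.
  by apply: profiled_land; lia.
(* An [X] records an ascent of length one at [j], so [j] is refused. *)
have [nE _] := stack_split t w1 w2 false.
have := cc'; rewrite cE /step /= -/t ltnNge (leq_trans jl) //=.
rewrite ltn_eqF // size_stack;
  have hw : height w = height w2 + (height w1).+1 by rewrite wE height_cat.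
rewrite (_ : t + height w - j = (height w2).+1) /=; last lia.
rewrite wE (set_nth_default 0) ?size_stack ?nE -?wE; last lia.
have -> : j < t + height w by lia.
have -> : height w2 < height w by lia.
by rewrite -jE eqxx.
Qed.

End Profiles.

(** * Reachability of all coded configurations *)

Section Reachable.
Variable N : nat.
Implicit Types (w u : seq (option bool)) (t m g b d j l k : nat) (c : config).
Notation stack := (stack N).
Notation config_of := (config_of N).
Notation profiled := (profiled N).

Inductive reach : config -> Prop :=
| reach_start : reach (start_config N)
| reach_step c c' j : reach c -> j <= N -> step c j = Some c' -> reach c'.

Lemma reach_reads c : reach c <-> exists x : word N.+1, reads x c.
Proof.
split=> [|[x]].
  elim=> [|{}c c' j _ [x xc] jN cc']; first by exists [::]; exact: reads_nil.
  exists (rcons x (inord j)); apply: reads_rcons xc _.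
  by rewrite inordK.
elim=> [|{}x {}c j c' _ rc cc']; first exact: reach_start.
exact: reach_step rc (ltn_ord j : j <= N) cc'.
Qed.

Lemma reach_flat m : m <= N -> reach (config_of (nseq m D) 0).
Proof.
move=> mN; rewrite /config_of size_nseq height_nseq mul0n !addn0.
have := stack_nseqD N (N - m) m [::]; rewrite cats0 => ->.
case: m mN => [|m] mN; first by rewrite subn0; exact: reach_start.
apply: (reach_step reach_start (leq_subr m.+1 N)).
rewrite /step /= ltnNge (leq_trans (leq_subr _ _)) //= ltn_eqF ?ltnS ?leq_subr //.
by rewrite subKn //= andbF nth_nil.
Qed.

Lemma nseqS_cat m (a : option bool) w : nseq m.+1 a ++ w = nseq m a ++ a :: w.
Proof. by elim: m => //= m <-. Qed.

Lemma reach_push w1 w2 d : drops w2 = 0 -> size (w2 ++ D :: w1) <= N -> d != 1 ->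
  reach (config_of (w2 ++ D :: w1) d) -> reach (config_of (X :: w2 ++ w1) d.-1).
Proof.
move=> w2D wN d1 rw; apply: reach_step rw _ (step_config_of_push w2D wN d1).
have := size_height_drops (w2 ++ D :: w1); rewrite drops_cat drops_cons /=; lia.
Qed.

Lemma reach_last l e s : reach (l, e, s) -> l <= N ->
  reach (l, l, map (prolong l) s).
Proof.
move=> r lN; apply: reach_step r lN _.
by rewrite /step ltnNge leqnSn /= ltn_eqF // ltnn subnn drop0.
Qed.

(** Reading the last letter again prolongs the top ascent up to that letter, which is the level that
    [V] pushes. *)
Lemma reach_prolong w : size w < N -> reach (config_of (X :: w) 0) ->
  reach (config_of (V :: w) 0).
Proof.
move=> wN rw; have sw := size_height_drops w.
have tN : N - size (X :: w) + size w < N by rewrite /=; lia.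
have := reach_last rw; rewrite prolong_stack_X //.
rewrite /config_of /= !height_cons /= addn0 => r.
by rewrite (_ : N - drops w = N - (size w).+1 + (1 + height w)); [apply: r|]; lia.
Qed.

(** Reading the initial letter of the upper [V] uncovers the stack of [V :: w1], where no ascent
    gets prolonged; reading it once more resets [e] to it. *)
Lemma reach_pop2 w1 w2 : size (w2 ++ V :: V :: w1) <= N ->
  reach (config_of (w2 ++ V :: V :: w1) 0) ->
  reach (config_of (nseq (size w2).+1 D ++ V :: w1) 0).
Proof.
move=> wN rw; have sw := size_height_drops w1.
have wE : size (w2 ++ V :: V :: w1) = size w2 + (size w1).+2 by rewrite size_cat.
have := step_config_of_pop 0 wN; cbv zeta; set t := N - size _;
  set j := t + _ => st.
have jE : j = t + (height w1).+1 by rewrite /j height_cons.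
have jN : j <= N by lia.
have idE : map (prolong j) (stack t (V :: w1)) = stack t (V :: w1).
  by apply: map_prolong_id => x; rewrite inE => /predU1P [->|/stack_mem]; lia.
rewrite idE in st; have := reach_last (reach_step rw jN st) jN; rewrite idE.
rewrite /config_of size_cat size_nseq height_cat height_nseq stack_nseqD /= addn0 mul0n add0n.
by rewrite (_ : N - (_ + _) = t) // /t wE addSnnS.
Qed.

(** The letters of [u] are placed from the bottom up, while the positions above still hold [D]. *)
Lemma reach_fill m w1 u : size u = m -> size w1 + m <= N ->
  reach (config_of (nseq m D ++ w1) 0) -> reach (config_of (u ++ w1) 0).
Proof.
elim: m w1 u => [|m IH] w1 u um wm rw; first by case: u um rw.
case/lastP: u um => // u a; rewrite size_rcons => -[um]; rewrite cat_rcons.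
have sE (c : option bool) : size (nseq m c ++ D :: w1) = (m + size w1).+1.
  by rewrite size_cat size_nseq addnS.
rewrite nseqS_cat in rw; have s1 : size (D :: w1) + m <= N by rewrite /=; lia.
case: a => [[]|]; last exact: IH.
(* To place a [V] at the bottom, the positions above are filled with [V], a push deletes the [D]
   below them, and the new [X] is prolonged to a [V]. Then [reach_pop2] clears all but the lowest
   [V]. *)
- have {}rw : reach (config_of (nseq m.+1 V ++ w1) 0).
    apply: reach_prolong; first by rewrite size_cat size_nseq; lia.
    apply: (reach_push (d := 0)) => //; first by rewrite drops_nseq.
      by rewrite sE; lia.
    exact: IH (size_nseq m V) s1 rw.
  case: m IH um wm sE s1 rw => [|m] IH um wm sE s1 rw; first by case: u um.
  apply: IH => //.
  rewrite !nseqS_cat in rw; have := reach_pop2 _ rw.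
  by rewrite size_cat size_nseq /=; apply; lia.
- apply: IH => //.
  rewrite (config_of_same_stack _ (same_stack_DnX N m w1)).
  rewrite -nseqS_cat in rw; apply: (@reach_push _ [::] 0) => //=.
  by rewrite size_cat size_nseq; lia.
Qed.

Lemma reach_type1 w : size w <= N -> reach (config_of w 0).
Proof.
move=> wN; rewrite -[w]cats0; apply: (reach_fill erefl); rewrite ?add0n //.
by rewrite cats0; exact: reach_flat.
Qed.

Lemma reach_pop w1 w2 : size (w2 ++ V :: w1) <= N ->
  let t := N - size (w2 ++ V :: w1) in
  reach (t + height w1, N - drops w1, map (prolong (t + height w1)) (stack t w1)).
Proof.
move=> wN t; have := reach_type1 wN => rw;
  apply: reach_step rw _ (step_config_of_pop 0 wN).
by have := size_height_drops w1; move: wN; rewrite /t size_cat /=; lia.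
Qed.

(** Popping a [V] right above [w] leaves [e] at the end of its ascent, [b + 1] beyond the last
    letter. A leading [X] of [w] would be prolonged by this, so it is pushed afterwards, starting
    from a gap larger by one. *)
Lemma reach_gapped0 w b : reduced w -> size w + b < N ->
  reach (config_of (gapped w 0 b) b.+1).
Proof.
have pop u k : reduced u -> ~~ xhead u -> size u + k < N ->
    reach (config_of (gapped u 0 k) k.+1).
  move=> nu xu uc; have sE : size (nseq k V ++ V :: u) = size u + k.+1.
    by rewrite size_cat size_nseq /=; lia.
  have := @reach_pop u (nseq k V); rewrite sE => /(_ ltac:(lia)) /=.
  rewrite prolong_stack_reduced //; last lia.
  rewrite /config_of size_gapped height_gapped !addn0 stack_nseqD.
  by rewrite (_ : N - drops u = N - (size u + k.+1) + height u + k.+1) //;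
    have := size_height_drops u; lia.
elim: w b => [|a w IH] b nw wb; first exact: pop.
have [|xw] := boolP (xhead (a :: w)); last exact: pop.
case: a nw wb => [[]|] // nw wb _.
have r : reach (config_of (D :: nseq b.+1 D ++ w) b.+2).
  by apply: (IH b.+1) => //; move: wb; rewrite /=; lia.
rewrite (config_of_same_stack _ (same_stack_DnX N b.+1 w));
  apply: (@reach_push _ [::] b.+2) => //.
by move: wb; rewrite /= size_cat size_nseq; lia.
Qed.

(** Popping down to [X :: w] prolongs this [X] and gives [g = 1]; each further push raises [g] by
    one and lowers [b] by one. *)
Lemma reach_gapped w g b : reduced w -> size w + g + b < N ->
  reach (config_of (gapped w g b) b.+1).
Proof.
case: g => [|g] nw; first by rewrite addn0; exact: reach_gapped0.
elim: g b => [|g IH] b wb.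
  have sE : size (nseq b V ++ V :: X :: w) = size w + b.+2.
    by rewrite size_cat size_nseq /=; lia.
  have := @reach_pop (X :: w) (nseq b V); rewrite sE => /(_ ltac:(lia)).
  cbv zeta; rewrite prolong_stack_X; last lia.
  have sw := size_height_drops w; set t := N - _ => r.
  rewrite /config_of size_gapped height_gapped /gapped [_ ++ _]/= /= stack_nseqD.
  rewrite drops_cons drops_cat drops_nseq (_ : N - (_ + _) = t) /=;
    last by rewrite /t; lia.
  rewrite drops_cons height_cons [isSome _ + _]addnC /= add0n in r.
  rewrite (_ : N - (1 + (1 * b + drops w)) = t + (height w + 1));
    last by rewrite /t; lia.
  by rewrite (_ : N - drops w = t + (height w + 1) + b.+1) in r;
    last by rewrite /t; lia.
have r : reach (config_of (gapped w g.+1 b.+1) b.+2) by apply: IH; lia.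
have := @reach_push (nseq b.+1 D ++ w) (nseq g X ++ [:: V]) b.+2; rewrite -catA.
apply=> //; first by rewrite drops_cat drops_nseq.
  by rewrite !size_cat /= !size_cat !size_nseq; lia.
by rewrite /gapped -catA in r.
Qed.

Lemma profiled_start : profiled (start_config N).
Proof. by left; exists [::]; split=> //; rewrite /config_of subn0 !addn0. Qed.

Lemma reach_profiled c : reach c <-> profiled c.
Proof.
split=> [|[[w [_ wN ->]]|[w [g [b [nw wN ->]]]]]].
- elim=> [|{}c c' j _ fc jN cc']; first exact: profiled_start.
  exact: profiled_step fc jN cc'.
- exact: reach_type1.
- exact: reach_gapped.
Qed.

(** * Uniqueness of the codes *)

Lemma stack_inj t w u : reduced w -> reduced u -> size w = size u ->
  height w = height u ->
  t + size w <= N -> stack t w = stack t u -> w = u.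
Proof.
elim: w u => [|a w IH] [|c u] // nw nu [sz] hE tN st.
have [sw su] := (size_height_drops w, size_height_drops u).
have nw' : reduced w by case/andP: nw.
have nu' : reduced u by case/andP: nu.
rewrite /= in tN.
(* If only one of the words has [D] on top, the top entry of the other falls between the two bounds
   that [stack_mem] or [stack_mem_reduced] gives for [v]. *)
have topD v a' u' : reduced (D :: v) -> reduced (Some a' :: u') ->
  size v = size u' ->
    height v = (height u').+1 -> t + (size u').+1 <= N ->
    stack t v <> stack t (Some a' :: u').
  move=> /andP [/= xv nv] nu'' szv hv tN' E.
  have [sv su'] := (size_height_drops v, size_height_drops u').
  case: a' {nu''} E => /= E.
    have /stack_mem : N - drops u' \in stack t v by rewrite E mem_head.
    by lia.
  have /(stack_mem_reduced nv xv) : t + height u' \in stack t v by rewrite E mem_head.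
  by lia.
case: a nw hE st => [a|] nw; case: c nu => [c|] nu;
  rewrite !height_cons /= => hE st.
- have {}hE : height w = height u by lia.
  have st' : stack t w = stack t u by move: st; case: (a); case: (c) => -[].
  rewrite (IH u) //; last lia.
  move: st; rewrite st'; case: (a); case: (c) => // -[]; lia.
- case: (topD u a w nu nw) => //; lia.
- by case: (topD w c u nw nu) => //; lia.
- by rewrite (IH u) //; lia.
Qed.

Lemma config_of_size w d u d' : size w <= N -> size u <= N ->
  config_of w d = config_of u d' ->
  size w = size u /\ height w = height u.
Proof.
move=> wN uN [lE _ /(congr1 size)]; rewrite !size_stack => hE.
by split=> //; lia.
Qed.

Lemma index_stack_X t h w l : l = N - drops w -> t + height w + h < l ->
  index l (stack t (nseq h X ++ V :: w)) = h.
Proof.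
move=> -> ; elim: h => [|h IH] tl /=; first by rewrite eqxx.
by rewrite height_cat height_nseq height_cons /= IH ?ifN_eqC //; lia.
Qed.

(** The position of [l] in the stack, together with the height, reveals [g]. For [g = 0] the letter
    [l] is absent, so [index] returns the size of the stack. *)
Lemma index_gapped w g b : size w + g + b < N ->
  index (config_of (gapped w g b) 0).1.1 (config_of (gapped w g b) 0).2 =
    if g is h.+1 then h else height w.
Proof.
move=> wN; have sw := size_height_drops w.
rewrite /= size_gapped height_gapped; set t := N - _.
case: g wN @t => [|h] wN t.
  rewrite stack_nseqD addn0 -(size_stack N t w); apply: memNindex.
  by apply/negP => /stack_mem; rewrite size_stack /t; lia.
rewrite /gapped -catA index_stack_X ?drops_cat ?height_cat ?drops_nseq ?height_nseq /= /t; lia.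
Qed.

Lemma gapped_inj w g b u g' b' : reduced w -> reduced u ->
  size w + g + b < N -> size u + g' + b' < N ->
  config_of (gapped w g b) b.+1 = config_of (gapped u g' b') b'.+1 ->
  [/\ w = u, g = g' & b = b'].
Proof.
move=> nw nu wN uN E.
have wN' : size (gapped w g b) <= N by rewrite size_gapped; lia.
have uN' : size (gapped u g' b') <= N by rewrite size_gapped; lia.
have [] := config_of_size wN' uN' E; rewrite !size_gapped !height_gapped => sE hE.
have bE : b = b' by case: E; rewrite !size_gapped !height_gapped; lia.
have E0 : config_of (gapped w g b) 0 = config_of (gapped u g' b') 0.
  by case: E => lE _ st; rewrite /config_of lE st.
have := index_gapped wN; rewrite E0 index_gapped //.
move=> iE.
have gE : g = g' by case: g g' iE hE {E E0 wN uN wN' uN' sE} => [|g] [|g'] /=; lia.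
subst g' b'; split=> //.
apply: (@stack_inj (N - size (gapped w g b))) => //; rewrite ?size_gapped;
  [lia|lia|lia|].
case: E => _ _; rewrite !size_gapped (_ : size u = size w); last lia.
have dropE v t : drop g (stack t (gapped v g b)) = stack t v.
  rewrite /gapped; case: g {E0 iE wN uN wN' uN' sE hE} => [|h].
    by rewrite drop0 stack_nseqD.
  rewrite -catA; elim: h => [|h IH] //=; by rewrite drop0 stack_nseqD.
by move/(congr1 (drop g)); rewrite !dropE.
Qed.

Lemma config_of0_inj w u : reduced w -> reduced u -> size w <= N -> size u <= N ->
  config_of w 0 = config_of u 0 -> w = u.
Proof.
move=> nw nu wN uN E; have [sE hE] := config_of_size wN uN E.
case: E => _ _; rewrite -sE; apply: stack_inj => //; lia.
Qed.

(* [None] encodes the configurations [l = e], [Some (g, b)] those with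
   [e = l + b + 1] and [g] letters of the stack below [l]. *)
Definition param := (seq (option bool) * option (nat * nat))%type.

Definition decode (p : param) : config :=
  match p.2 with
  | None => config_of p.1 0
  | Some (g, b) => config_of (gapped p.1 g b) b.+1
  end.

Definition valid (p : param) : bool :=
  reduced p.1 && match p.2 with
  | None => size p.1 <= N
  | Some (g, b) => size p.1 + g + b < N
  end.

Lemma profiled_decode c : profiled c <-> exists2 p, valid p & decode p = c.
Proof.
split=> [[[w [nw wN ->]]|[w [g [b [nw wN ->]]]]]|[[w [[g b]|]] /andP [nw wN] <-]].
- by exists (w, None) => //; rewrite /valid nw.
- by exists (w, Some (g, b)) => //; rewrite /valid nw.
- by right; exists w, g, b.
- by left; exists w.
Qed.

Lemma decode_inj : {in valid &, injective decode}.
Proof.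
move=> [w o] [u o'] /andP [/= nw wN] /andP [/= nu uN]; rewrite /decode /=.
case: o o' wN uN => [[g b]|] [[g' b']|] wN uN.
- by move=> /(gapped_inj nw nu wN uN) [-> -> ->].
- by case; lia.
- by case; lia.
- by move/(config_of0_inj nw nu wN uN) => ->.
Qed.

(** * Enumeration and count of the codes *)

Fixpoint profiles k : seq (seq (option bool)) :=
  if k is k'.+1 then
    [seq V :: w | w <- profiles k'] ++ [seq X :: w | w <- profiles k'] ++
    [seq D :: w | w <- profiles k' & ~~ xhead w]
  else [:: [::]].

Lemma mem_profiles k w : (w \in profiles k) = (size w == k) && reduced w.
Proof.
have consE (a c : option bool) u s : (a :: u \in [seq c :: v | v <- s]) =
  (a == c) && (u \in s).
  apply/mapP/andP => [[v vs [-> ->]]|[/eqP -> us]]; first by rewrite eqxx.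
  by exists u.
elim: k w => [|k IH] [|a w]; rewrite ?inE //.
  by rewrite /= !mem_cat; do 3! (case: mapP => [[]//|_]).
rewrite [profiles _]/= !mem_cat !consE mem_filter !IH /= eqSS.
by case: a => [[]|] /=; rewrite ?orbF //; case: (xhead w); rewrite ?andbF.
Qed.

Lemma profiles_uniq k : uniq (profiles k).
Proof.
elim: k => //= k IH; rewrite !cat_uniq !map_inj_uniq ?filter_uniq ?IH //=;
  try by move=> ? ? [].
rewrite andbT; apply/andP; split; apply/hasPn => w.
  by rewrite mem_cat => /orP [] /mapP [u _ ->]; apply/mapP => -[].
by move=> /mapP [u _ ->]; apply/mapP => -[].
Qed.

(** Words starting with [X] are counted along because no [D] may precede them: with [p] for all
    words and [x] for these, [p(k+1) = 3 p(k) - x(k)] and [x(k+1) = p(k)], the recursion of the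
    Fibonacci numbers of even index. *)
Lemma size_profiles k :
  size (profiles k) = fib k.*2.+2 /\ count xhead (profiles k) = fib k.*2.
Proof.
elim: k => [|k [sk ck]] //.
have fE : fib k.+1.*2.+2 + fib k.*2 = 3 * fib k.*2.+2 by rewrite doubleS /=; lia.
split.
  rewrite [profiles _]/= !size_cat !size_map size_filter.
  rewrite (eq_count (a2 := predC xhead)) //.
  by have := count_predC xhead (profiles k); rewrite ck sk; lia.
rewrite [profiles _]/= !count_cat !count_map (eq_count (a2 := pred0)) // count_pred0.
rewrite (eq_count (a2 := predT)) // count_predT sk (eq_count (a2 := pred0)) //.
by rewrite count_pred0 addn0.
Qed.

Fixpoint gaps m : seq (nat * nat) :=
  if m is m'.+1 then [seq (g, m' - g) | g <- iota 0 m] ++ gaps m' else [::].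

Lemma gapsS m :
  gaps m.+1 = [seq (g, m - g) | g <- iota 0 m.+1] ++ gaps m.
Proof. by []. Qed.

Lemma mem_gaps m g b : ((g, b) \in gaps m) = (g + b < m).
Proof.
elim: m => [|m IH] //; rewrite gapsS mem_cat IH;
  apply/orP/idP => [[/mapP [h]|]|]; rewrite ?mem_iota.
- by move=> hm [-> ->]; lia.
- by lia.
- rewrite ltnS leq_eqVlt => /predU1P [gb|gb]; last by right.
  left; apply/mapP; exists g; first by rewrite mem_iota; lia.
  by congr (_, _); lia.
Qed.

Lemma gaps_uniq m : uniq (gaps m).
Proof.
elim: m => [|m IH] //; rewrite gapsS cat_uniq IH map_inj_uniq ?iota_uniq;
  last by move=> ? ? [].
rewrite andbT; apply/hasPn => -[g b]; rewrite mem_gaps => gb.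
by apply/mapP => -[h]; rewrite mem_iota => hm [gE bE]; lia.
Qed.

Lemma size_gaps m : size (gaps m) = 'C(m.+1, 2).
Proof.
elim: m => [|m IH] //;
  by rewrite gapsS size_cat size_map size_iota IH [RHS]binS bin1 addnC.
Qed.

Definition params_at k : seq param :=
  [seq (w, o) | w <- profiles k, o <- None :: map Some (gaps (N - k))].

Fixpoint params k : seq param := if k is k'.+1 then params k' ++ params_at k' else [::].

Lemma mem_params k p : (p \in params k) =
  [&& size p.1 < k, p.1 \in profiles (size p.1)
    & p.2 \in None :: map Some (gaps (N - size p.1))].
Proof.
elim: k => [|k IH] //=; rewrite mem_cat IH; case: p {IH} => w o /=.
have -> : ((w, o) \in params_at k) =
    (w \in profiles k) && (o \in None :: map Some (gaps (N - k))).
  apply/allpairsP/andP => [[[w' o'] /= [wk admits [-> ->]]]|[wk admits]] //.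
  by exists (w, o).
rewrite [w \in profiles k]mem_profiles mem_profiles eqxx /= [size w < k.+1]ltnS [size w <= k]leq_eqVlt.
by case: eqP => [->|_]; rewrite ?ltnn /= ?orbF.
Qed.

Lemma validE p : valid p = (p \in params N.+1).
Proof.
rewrite mem_params mem_profiles eqxx /valid ltnS /= inE; case: p => w [[g b]|] /=.
  rewrite mem_map; last by move=> ? ? [].
  rewrite mem_gaps; case: (reduced w); rewrite ?andbF //=; lia.
by rewrite andbT andbC.
Qed.

Lemma params_uniq k : uniq (params k).
Proof.
elim: k => //= k IH; rewrite cat_uniq IH /=; apply/andP; split.
  apply/hasPn => -[w o] /allpairsP [[w' o'] /= [+ _ [-> _]]].
  by rewrite mem_profiles mem_params => /andP [/eqP <- _]; rewrite ltnn.
apply: allpairs_uniq; [exact: profiles_uniq| |by move=> [? ?] [? ?] _ _ [-> ->]].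
rewrite /= map_inj_uniq ?gaps_uniq ?andbT; last by move=> ? ? [].
by apply/mapP => -[].
Qed.

(** Codes of length [k] give the summand [i = k + 1]: each of the [fib (2 k + 2)] words is paired
    with [None] or with a pair from [gaps (N - k)]. *)
Lemma size_params : size (params N.+1) =
  \sum_(1 <= i < N.+2) ('C(N.+1 + 1 - i, 2) + 1) * fib (2 * i).
Proof.
rewrite big_add1 /= -/(params N.+1).
have gen k : k <= N.+1 -> size (params k) =
    \sum_(0 <= i < k) ('C(N.+1 + 1 - i.+1, 2) + 1) * fib (2 * i.+1).
  elim: k => [|k IH] kN; first by rewrite big_nil.
  rewrite big_nat_recr // -IH; last exact: ltnW.
  rewrite [params _]/= size_cat size_allpairs [size (_ :: _)]/=.
  rewrite (size_profiles k).1 (_ : N.+1 + 1 - k.+1 = (N - k).+1); last lia.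
  have -> : 2 * k.+1 = k.*2.+2 by lia.
  by congr (_ + _); rewrite mulnC size_map size_gaps addn1.
exact: gen.
Qed.

End Reachable.

(** States are numbered by the positions of their codes in [params]; distinct codes give distinct
    configurations, and these give distinct states. *)
Lemma card_states_Gamma N : (states (Gamma N.+1) #=
  `I_(\sum_(1 <= i < N.+2) ('C(N.+1 + 1 - i, 2) + 1) * fib (2 * i)))%card.
Proof.
rewrite -size_params; set s := params _ _.
pose f i := @res_set N (decode N (nth ([::], None) s i)).
have -> : states (Gamma N.+1) = (f @` `I_(size s))%classic.
  rewrite states_GammaE; apply/seteqP;
    split=> [_ [c /reach_reads/reach_profiled/profiled_decode [p vp <-] <-]|_ [i /= si <-]].
    move: vp; rewrite validE => ps; exists (index p s);
      first by rewrite /= index_mem.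
    by rewrite /f nth_index.
  exists (decode N (nth ([::], None) s i)) => //.
  apply/reach_reads/reach_profiled/profiled_decode;
    exists (nth ([::], None) s i) => //.
  by rewrite validE mem_nth.
apply: inj_card_eq => i j; rewrite !inE /= => si sj fij.
have wf_nth k : k < size s -> wf_config N (decode N (nth ([::], None) s k)).
  move=> sk; have [x /reads_spec []//] : exists x : word N.+1,
    reads x (decode N (nth ([::], None) s k)).
  apply/reach_reads/reach_profiled/profiled_decode;
    exists (nth ([::], None) s k) => //.
  by rewrite validE mem_nth.
have := res_set_inj (wf_nth i si) (wf_nth j sj) fij.
move/decode_inj; rewrite -!topredE /= !validE !mem_nth // => /(_ isT isT)/eqP.
by rewrite nth_uniq ?params_uniq // => /eqP.
Qed.

Local Open Scope classical_set_scope.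
Local Open Scope card_scope.
Local Open Scope nat_scope.

Theorem theorem4p2 (n : nat) (n_ge1 : 1 <= n) :
  [/\ accepted (Gamma n) = max_lang n,
      states (Gamma n) #=
        `I_(\sum_(1 <= i < n.+1) ('C(n + 1 - i, 2) + 1) * fib (2 * i)),
      accepted (Gamma_min n) = min_lang n
    & states (Gamma_min n) #=
        `I_(\sum_(1 <= i < n.+1) ('C(n + 1 - i, 2) + 1) * fib (2 * i))].
Proof.
case: n n_ge1 => // N _; split.
- exact: accepted_Gamma.
- exact: card_states_Gamma.
- exact: accepted_Gamma_min.
(* Relabelling changes the arrows and keeps the set of states. *)
- exact: card_states_Gamma.
Qed.
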